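(* Let $K$ be a field of characteristic zero, $n\ge 1$ an integer, $A=K[x_0,\dots,x_n]$, and $f\in A$ a nonzero homogeneous polynomial of positive degree. Then there exists an integer $r\ge 1$, depending only on $f$, such that for all integers $q\ge 1$ and all $R\in M_q$ homogeneous of degree $-n-1$, the following assertions are equivalent: (1) $R\in\sum_{i=0}^n\partial_i A_f$; (2) there exists $R'\in M_{q-1}\cap\sum_{i=0}^n\partial_i A_f$ such that $(R,R')\in W_q^r$.
   Context: $A_f=A[1/f]$ is the localization and $\partial_i=\partial/\partial x_i$. $\sum_{i=0}^n\partial_iA_f$ is the $K$-linear subspace of $A_f$ of all sums $\sum_i\partial_i(B_i)$ with $B_i\in A_f$. For $q\ge 0$, $M_q\subset A_f$ is the set of rational functions of the form $a/f^q$ with $a\in A$. For $q\ge1$, subspaces $W_q^r\subset M_q\times M_{q-1}$, $r\geq 1$, are defined by $$W_q^1=\left\{\left((q-1)\frac{\sum_{i=0}^n b_i\partial_i f}{f^q},\ \frac{\sum_{i=0}^n\partial_i b_i}{f^{q-1}}\right)\ :\ b_0,\dots,b_n\in A\right\},$$ $$W_q^{r+1}=W_q^r+\left\{(R,0)\ :\ (0,R)\in W_{q+1}^r\right\}.$$ A rational function is homogeneous of degree $-n-1$ if $R(\lambda x_0,\dots,\lambda x_n)=\lambda^{-n-1}R(x_0,\dots,x_n)$. *)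

(* Defs.v *)
From mathcomp Require Export all_boot all_order all_algebra.
From mathcomp Require Export mpoly.
From mathcomp Require Import ring.

Set Implicit Arguments.
Unset Strict Implicit.
Unset Printing Implicit Defensive.

Import GRing.Theory.
Local Open Scope ring_scope.
Local Open Scope quotient_scope.

Section Fraction.

Variable R : idomainType.
Local Notation "p %:F" := (@FracField.tofrac R p) : ring_scope.

Definition rnum (x : {fraction R}) : R := \n_(repr x).
Definition rden (x : {fraction R}) : R := \d_(repr x).

Lemma rden_neq0 (x : {fraction R}) : rden x != 0.
Proof. exact: denom_ratioP. Qed.

Lemma fracE (x : {fraction R}) : x = (rnum x)%:F / (rden x)%:F.
Proof.
have hE (a b : R) (hb : b != 0) : \pi_{fraction R} (Ratio a b) = a%:F / b%:F.
  apply: (mulIf (x := b%:F)); first by rewrite tofrac_eq0.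
  rewrite divfK ?tofrac_eq0 //; unlock FracField.tofrac.
  rewrite -[LHS]FracField.pi_mul; apply/eqP.
  rewrite FracField.equivf_def /FracField.mulf.
  by rewrite !numden_Ratio ?(oner_neq0, mulf_neq0) // !mulr1 mulrC.
by rewrite -hE ?rden_neq0 // Ratio_numden reprK.
Qed.

Lemma eq_frac (a b c d : R) : b != 0 -> d != 0 ->
  (a%:F / b%:F == c%:F / d%:F) = (a * d == c * b).
Proof. by move=> hb hd; rewrite eqr_div ?tofrac_eq0 // -!tofracM tofrac_eq. Qed.

Lemma rnum_rden (a b : R) : b != 0 ->
  rnum (a%:F / b%:F) * b = a * rden (a%:F / b%:F).
Proof.
move=> hb; apply/eqP; rewrite -eq_frac ?rden_neq0 //.
by rewrite -fracE.
Qed.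

End Fraction.

Lemma quotient_rule_indep (R : comNzRingType) (a b N D a' b' N' D' : R) :
  N * b = a * D -> N' * b + N * b' = a' * D + a * D' ->
  (N' * D - N * D') * b ^+ 2 = (a' * b - a * b') * D ^+ 2.
Proof.
move=> E E'.
have -> : (N' * D - N * D') * b ^+ 2 =
  (N' * b + N * b') * (D * b) - (N * b) * (b' * D + D' * b) by ring.
by rewrite E E'; ring.
Qed.

Section Defs.

Variables (K : fieldType) (n : nat).

(* Since f <> 0 and A is a domain, A_f = A[1/f] is represented as a subset of
   the fraction field of A, and so are its subspaces M_q. *)
Local Notation A := {mpoly K[n.+1]}.
Local Notation F := {fraction A}.
Local Notation "p %:F" := (@FracField.tofrac _ p) : ring_scope.

(* The partial derivative of K(x_0, ..., x_n): quotient rule on a representative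
   (independence of the representative is [fderivE]). *)
Definition fderiv (i : 'I_n.+1) (R : F) : F :=
  ((rnum R)^`M(i) * rden R - rnum R * (rden R)^`M(i))%:F / ((rden R) ^+ 2)%:F.

Lemma fderivE (i : 'I_n.+1) (a b : A) : b != 0 ->
  fderiv i (a%:F / b%:F) = (a^`M(i) * b - a * b^`M(i))%:F / (b ^+ 2)%:F.
Proof.
move=> hb; apply/eqP; rewrite eq_frac ?expf_neq0 ?rden_neq0 //; apply/eqP.
have E := rnum_rden a hb.
by apply: quotient_rule_indep (E) _; rewrite -!mderivM E.
Qed.

(* The substitution x_i := lam * x_i, on polynomials and, for lam != 0, on
   rational functions (independence of the representative is [fdilateE]). *)
Definition pdilate (lam : K) (p : A) : A :=
  p \mPo [tuple lam *: 'X_i | i < n.+1].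

Definition fdilate (lam : K) (R : F) : F :=
  (pdilate lam (rnum R))%:F / (pdilate lam (rden R))%:F.

Lemma mcoeff_pdilate (lam : K) (p : A) (m : 'X_{1..n.+1}) :
  (pdilate lam p)@_m = lam ^+ mdeg m * p@_m.
Proof.
rewrite /pdilate comp_mpolyE raddf_sum /=.
have E (k : 'X_{1..n.+1}) :
    \prod_(i < n.+1) (tnth [tuple lam *: 'X_i | i < n.+1] i : A) ^+ k i
    = lam ^+ mdeg k *: 'X_[k].
  under eq_bigr => i _ do rewrite tnth_mktuple exprZn.
  by rewrite scaler_prod prodrXr -mdegE [in RHS]mpolyXE_id.
under eq_bigr => k _ do rewrite E !mcoeffZ mcoeffX mulrCA mulrA.
have [hm|hm] := boolP (m \in msupp p).
  rewrite (bigD1_seq m) ?msupp_uniq //= eqxx mulr1.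
  by rewrite big1 ?addr0 // => k /negPf ->; rewrite mulr0.
rewrite (memN_msupp_eq0 hm) mulr0 big_seq big1 // => k hk.
by case: eqP hk hm => [->->//|_ _ _]; rewrite mulr0.
Qed.

Lemma pdilate_neq0 (lam : K) (p : A) : lam != 0 -> p != 0 -> pdilate lam p != 0.
Proof.
move=> hl; apply: contraNneq => E; apply/eqP/mpolyP => m; rewrite mcoeff0.
have := mcoeff_pdilate lam p m; rewrite E mcoeff0 => /esym/eqP.
by rewrite mulf_eq0 expf_eq0 (negPf hl) andbF /= => /eqP.
Qed.

Lemma fdilateE (lam : K) (a b : A) : lam != 0 -> b != 0 ->
  fdilate lam (a%:F / b%:F) = (pdilate lam a)%:F / (pdilate lam b)%:F.
Proof.
move=> hl hb; apply/eqP; rewrite eq_frac ?pdilate_neq0 ?rden_neq0 //.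
by rewrite /pdilate -!rmorphM rnum_rden.
Qed.

(* As lam^e may involve a negative power, lam ranges over K \ {0}. *)
Definition homogeneous (e : int) (R : F) : Prop :=
  forall lam : K, lam != 0 -> fdilate lam R = ((lam ^ e)%:MP)%:F * R.

Variable f : A.

Definition M (q : nat) (R : F) : Prop := exists a : A, R = a%:F / f%:F ^+ q.

Definition Af (R : F) : Prop := exists q : nat, M q R.

Definition sum_dAf (R : F) : Prop :=
  exists B : 'I_n.+1 -> F,
    (forall i, Af (B i)) /\ R = \sum_(i < n.+1) fderiv i (B i).

Definition W1 (q : nat) (R R' : F) : Prop :=
  exists b : 'I_n.+1 -> A,
    R = (q.-1)%:R * ((\sum_(i < n.+1) b i * f^`M(i))%:F / f%:F ^+ q) /\
    R' = (\sum_(i < n.+1) (b i)^`M(i))%:F / f%:F ^+ q.-1.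

(* [W r q R R'] reads (R, R') \in W_q^r.  Only q >= 1 and r >= 1 are meaningful;
   W_q^0 is a dummy value, on which no W_q^r with r >= 1 depends. *)
Fixpoint W (r q : nat) (R R' : F) {struct r} : Prop :=
  match r with
  | 0 => False
  | 1 => W1 q R R'
  | ((_.+1) as r').+1 =>
      exists S T : F, [/\ R = S + T, W r' q S R' & W r' q.+1 0 T]
  end.

End Defs.

(* Main.v *)
(** Replacing a / f^q by a formal symbol a T^q turns the relation W_q^r into: a T^q is, up to
    formal pole order q - 1, a total derivative of symbols of formal order at most q + r - 2.
    Modulo total derivatives, a T^q is the same as a f T^(q+1) in degree -n-1: by Euler's identity
    the difference is the divergence of a multiple of x a T^q. Hence every R in the sum of the
    ∂_i A_f has some r, and for each q a single r serves, by finite dimension.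

    For large q a uniform r comes from the Bernstein-Sato functional equation
    b(s) f^s = P(s) f^(s+1): at s = -q, transposing P(-q) onto a shows that a / f^q is of pole
    order q - 1 up to derivatives of fractions whose pole order exceeds q by at most the order of
    P. The equation itself is Bernstein's argument over the field K(s): if no f^(s-j-1) were in
    the D-module generated by f^(s-j), then for j < h each quotient would contribute at least h^n
    dimensions to a space of dimension O(h^n), n being the number of variables. *)
Require Import Defs.
From mathcomp Require Import ssrcomplements zify ring.
From Stdlib Require Import Classical ClassicalEpsilon.

Set Implicit Arguments.
Unset Strict Implicit.
Unset Printing Implicit Defensive.

Import GRing.Theory.
Local Open Scope ring_scope.

(** * Linear algebra modulo subspaces *)

Section LinearAlgebra.

Variables (E : fieldType) (A : nzRingType) (sc : {rmorphism E -> A}).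

Lemma wide_kernel (I J : finType) (M : I -> J -> E) : (#|J| < #|I|)%N ->
  exists2 c : I -> E, exists i, c i != 0 & forall j, \sum_i c i * M i j = 0.
Proof.
move=> hIJ; pose B : 'M[E]_(#|I|, #|J|) := \matrix_(i, j) M (enum_val i) (enum_val j).
have : kermx B != 0.
  by rewrite -mxrank_eq0 mxrank_ker subn_eq0 -ltnNge (leq_ltn_trans (rank_leq_col _)).
move=> /rowV0Pn [v /sub_kermxP hv /rV0Pn [i hi]].
exists (fun x => v 0 (enum_rank x)); first by exists (enum_val i); rewrite enum_valK.
move=> j; have /matrixP/(_ 0 (enum_rank j)) := hv; rewrite !mxE => h; rewrite -{}[RHS]h.
rewrite (reindex (fun k : 'I_#|I| => enum_val k)) /=; last first.
  by exists enum_rank => x _; rewrite ?enum_valK ?enum_rankK.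
by apply: eq_bigr => k _; rewrite mxE enum_valK enum_rankK.
Qed.

Variable V : lmodType A.
Implicit Types (N G : V -> Prop) (v : nat -> V).

(** Scalars act through [sc]: [V] is a module over a larger ring, but dimensions are counted over
    the field [E]. *)
Definition subspace N := N 0 /\ forall (a : E) u w, N u -> N w -> N (sc a *: u + w).

Definition indep_mod N g v := forall a : nat -> E,
  N (\sum_(i < g) sc (a i) *: v i) -> forall i, (i < g)%N -> a i = 0.

Lemma subspaceD N u w : subspace N -> N u -> N w -> N (u + w).
Proof. by move=> [_ h] hu hw; have := h 1 _ _ hu hw; rewrite rmorph1 scale1r. Qed.

Lemma subspaceZ N (a : E) u : subspace N -> N u -> N (sc a *: u).
Proof. by move=> [h0 h] hu; rewrite -[_ *: _]addr0; apply: h. Qed.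

Lemma subspaceN N u : subspace N -> N u -> N (- u).
Proof. by move=> hN hu; have := subspaceZ (- 1) hN hu; rewrite rmorphN1 scaleN1r. Qed.

Lemma subspace_sum N (I : Type) (r : seq I) (P : pred I) (F : I -> V) :
  subspace N -> (forall i, P i -> N (F i)) -> N (\sum_(i <- r | P i) F i).
Proof. by move=> hN; apply: big_ind => [|u w]; [case: hN | apply: subspaceD]. Qed.

(** An independent family in [G] of maximal length works: adding any [u] from [G] creates a relation
    modulo [N], in which the coefficient of [u] cannot vanish. *)
Lemma subspace_spanned N G D : subspace N -> subspace G ->
  (forall v, (forall i, G (v i)) -> ~ indep_mod N D v) ->
  exists g v, [/\ (g < D)%N, forall i, G (v i) &
    forall u, G u -> exists a : nat -> E, N (u - \sum_(i < g) sc (a i) *: v i)].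
Proof.
move=> hN hG hD; pose good g := exists2 v, forall i, G (v i) & indep_mod N g v.
have [g [[v hv hi] hmax]] : exists g, good g /\ ~ good g.+1.
  apply: NNPP => hno; suff : good D by case=> v hv; apply: hD.
  elim: D {hD} => [|g IHg].
    by exists (fun=> 0) => [_|a _ i]; [case: hG | rewrite ltn0].
  by apply: NNPP => hg; apply: hno; exists g.
exists g, v; split=> // [|u hu].
  rewrite ltnNge; apply/negP => hDg; apply: (hD v hv) => a ha.
  move=> i hiD; pose a' k := if (k < D)%N then a k else 0.
  have <- : a' i = a i by rewrite /a' hiD.
  apply: hi; last exact: leq_trans hDg.
  rewrite (big_ord_widen_cond g predT (fun k => sc (a k) *: v k) hDg) in ha.
  suff <- : \sum_(k < g | predT k && (k < D)%N) sc (a k) *: v k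
          = \sum_(k < g) sc (a' k) *: v k by [].
  rewrite big_mkcond /=; apply: eq_bigr => k _; rewrite /a'.
  by case: ifP; rewrite // rmorph0 scale0r.
apply: NNPP => hno; apply: hmax.
exists (fun i => if (i < g)%N then v i else u) => [i|a]; first by case: ifP.
rewrite big_ord_recr /= ltnn => ha.
have {}ha : N (\sum_(i < g) sc (a i) *: v i + sc (a g) *: u).
  suff <- : \sum_(i < g) sc (a i) *: (if (i < g)%N then v i else u)
    = \sum_(i < g) sc (a i) *: v i by [].
  by apply: eq_bigr => i _; rewrite ltn_ord.
have hg : a g = 0.
  apply/eqP/negP => /negP hag; apply: hno; exists (fun i => - ((a g)^-1 * a i)).
  have := subspaceZ (a g)^-1 hN ha; rewrite scalerDr scalerA -rmorphM mulVf //.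
  rewrite rmorph1 scale1r addrC scaler_sumr -sumrN.
  congr (N (_ + _)); apply: eq_bigr => i _.
  by rewrite rmorphN scaleNr opprK scalerA rmorphM.
rewrite hg rmorph0 scale0r addr0 in ha.
by move=> i; rewrite ltnS leq_eqVlt => /orP [/eqP -> //|]; apply: hi.
Qed.

(** The union of the chain is finite-dimensional. Each of its finitely many spanning vectors lies in
    some [X r], and the largest of these [r] serves. *)
Lemma subspace_chain_stable (X : nat -> V -> Prop) D :
  (forall r, subspace (X r)) -> (forall r u, X r u -> X r.+1 u) ->
  (forall v, (forall i, exists r, X r (v i)) -> ~ indep_mod (fun u => u = 0) D v) ->
  exists r0, forall r u, X r u -> X r0 u.
Proof.
move=> hX hS hD.
have mono r r' u : (r <= r')%N -> X r u -> X r' u.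
  by elim: r' => [|r' IH]; rewrite leq_eqVlt => /orP [/eqP <- //|//] /IH h /h /hS.
have h0 : subspace (fun u : V => u = 0).
  by split=> // a u w -> ->; rewrite scaler0 addr0.
have hU : subspace (fun u => exists r, X r u).
  split; first by exists 0%N; case: (hX 0%N).
  move=> a u w [r hr] [r' hr']; exists (maxn r r').
  by case: (hX (maxn r r')) => _; apply; [apply: mono hr|apply: mono hr'];
    rewrite ?leq_maxl ?leq_maxr.
have [g [v [_ hv hs]]] := subspace_spanned h0 hU hD.
have [r0 hr0] : exists r0, forall i, (i < g)%N -> X r0 (v i).
  elim: g {hs} => [|g [r0 IH]]; first by exists 0%N.
  have [r hr] := hv g; exists (maxn r0 r) => i.
  rewrite ltnS leq_eqVlt => /orP [/eqP ->|/IH].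
    by apply: mono hr; rewrite leq_maxr.
  by apply: mono; rewrite leq_maxl.
exists r0 => r u hu; have [|a /eqP] := hs u; first by exists r.
rewrite subr_eq0 => /eqP ->; apply: subspace_sum => // i _.
by apply: subspaceZ => //; apply: hr0.
Qed.

(** The top layer goes first: all lower layers lie in [N h], so independence modulo [N h] kills its
    coefficients, and induction handles the rest. *)
Lemma indep_mod_triangular (N : nat -> V -> Prop) m (v : nat -> nat -> V) :
  (forall j, subspace (N j)) -> (forall j u, N j u -> N j.+1 u) ->
  (forall j i, N j.+1 (v j i)) -> (forall j, indep_mod (N j) m (v j)) ->
  forall h (a : nat -> nat -> E),
    N 0 (\sum_(j < h) \sum_(i < m) sc (a j i) *: v j i) ->
    forall j i, (j < h)%N -> (i < m)%N -> a j i = 0.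
Proof.
move=> hN hS hv hi; elim=> [//|h IH] a; rewrite big_ord_recr /= => ha.
have mono r r' u : (r <= r')%N -> N r u -> N r' u.
  by elim: r' => [|r' IHr]; rewrite leq_eqVlt => /orP [/eqP <- //|//] /IHr k /k /hS.
have hh i : (i < m)%N -> a h i = 0.
  apply: (hi h (a h)); rewrite -[X in N h X](addKr (\sum_(j < h) \sum_(i < m) sc (a j i) *: v j i)).
  apply: subspaceD => //; last by apply: mono ha.
  apply: subspaceN => //; do 2!apply: subspace_sum => // ? _.
  by apply: subspaceZ => //; apply: mono (hv _ _).
move=> j i; rewrite ltnS leq_eqVlt => /orP [/eqP -> /hh //|]; apply: IH.
by move: ha; rewrite [X in _ + X]big1 ?addr0 // => k _; rewrite hh // rmorph0 scale0r.
Qed.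

End LinearAlgebra.

(** * Formal fractions and differential operators on them *)

Section FormalPoles.

Variables (R : comNzRingType) (n : nat).
Local Notation A := {mpoly R[n]}.
Local Notation V := {poly A}.

(* The coefficient of 'X^i in V stands for a numerator over f^(i - s), and
   [nabla] differentiates such a formal fraction without ever simplifying it. *)
Definition nabla (s : R) (f : A) (l : 'I_n) (v : V) : V :=
  map_poly (mderiv l) v + (f^`M(l) *: (s%:MP *: v - 'X * v^`())) * 'X.

(* f 'X - 1 generates the relation a f / f^(i+1) = a / f^i. *)
Inductive Dgen (s : R) (f : A) (j k : nat) : V -> Prop :=
| Dgen_base : (j < k)%N -> Dgen s f j k 'X^j
| Dgen_rel (w : V) : (size w < k)%N -> Dgen s f j k ((f *: 'X - 1) * w)
| Dgen_add (u w : V) : Dgen s f j k u -> Dgen s f j k w -> Dgen s f j k (u + w)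
| Dgen_scale (p : A) (u : V) : Dgen s f j k u -> Dgen s f j k (p *: u)
| Dgen_nabla l (u : V) : Dgen s f j k u -> (size u < k)%N -> Dgen s f j k (nabla s f l u).

Variables (s : R) (f : A).
Local Notation nab := (nabla s f).

(** This is the rule d(a f^(s-i)) = da f^(s-i) + (s-i) a df f^(s-i-1), read off at each power of
    ['X]. *)
Lemma coef_nabla l v i : (nab l v)`_i = mderiv l v`_i
  + (if i is i'.+1 then (s%:MP - i'%:R) * v`_i' * f^`M(l) else 0).
Proof.
rewrite coefD coef_map coefMX; congr (_ + _); case: i => [|i] //=.
rewrite coefZ coefB coefZ coefXM; case: i => [|i] /=; first by ring.
by rewrite coef_deriv; ring.
Qed.

Lemma nablaD l : {morph nab l : u v / u + v}.
Proof.
move=> u v; apply/polyP => i; rewrite coefD !coef_nabla !coefD mderivD.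
by case: i => [|i]; rewrite ?coefD; ring.
Qed.

Lemma nabla0 l : nab l 0 = 0.
Proof. by apply: (addrI (nab l 0)); rewrite -nablaD !addr0. Qed.

Lemma nablaN l : {morph nab l : u / - u}.
Proof. by move=> u; apply: (addrI (nab l u)); rewrite -nablaD !subrr nabla0. Qed.

Lemma nablaZ l (p : A) v : nab l (p *: v) = p^`M(l) *: v + p *: nab l v.
Proof.
apply/polyP => i; rewrite [RHS]coefD !coefZ !coef_nabla !coefZ mderivM.
by case: i => [|i]; rewrite ?coefZ; ring.
Qed.

Lemma nablaXl l v : nab l ('X_l *: v) = v + 'X_l *: nab l v.
Proof.
rewrite nablaZ mderivX mnm1E eqxx.
by rewrite (_ : (U_(l) - U_(l))%MM = 0%MM) ?mpolyX0 ?scale1r //; apply/mnmP => i; rewrite mnmBE subnn mnm0E.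
Qed.

Lemma nablaXr l m v : l != m -> nab l ('X_m *: v) = 'X_m *: nab l v.
Proof.
by move=> hlm; rewrite nablaZ mderivX mnm1E eq_sym (negPf hlm) scale0r scale0r add0r.
Qed.

Lemma size_nabla l (v : V) k : (size v <= k)%N -> (size (nab l v) <= k.+1)%N.
Proof.
move=> hv; apply/leq_sizeP => i hi; rewrite coef_nabla nth_default ?mderiv0 ?add0r; last first.
  exact: leq_trans hv (ltnW hi).
by case: i hi => [//|i hi]; rewrite nth_default ?mulr0 ?mul0r //; apply: leq_trans hv _.
Qed.

Lemma Dgen_mono j k k' u : (k <= k')%N -> Dgen s f j k u -> Dgen s f j k' u.
Proof.
move=> hk; elim=> [h|w h|? ? _ h _ h'|? ? _ h|? ? _ h h'].
- by apply: Dgen_base; apply: leq_trans hk.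
- by apply: Dgen_rel; apply: leq_trans hk.
- exact: Dgen_add.
- exact: Dgen_scale.
- by apply: Dgen_nabla => //; apply: leq_trans hk.
Qed.

Lemma size_Dgen j k u : Dgen s f j k u -> (size u <= k)%N.
Proof.
elim=> [h|w h|? ? _ h _ h'|? ? _ h|? ? _ h h'].
- by rewrite size_polyXn.
- apply/leq_sizeP => i hi; rewrite mulrBl mul1r -scalerAl coefB coefZ coefXM.
  case: i hi => [|i] hi /=; rewrite !nth_default ?mulr0 ?subr0 //; clear -h hi; by rewrite ?ltnS in hi *; try exact: leq_trans (ltnW h) hi; try exact: leq_trans h hi.
- by rewrite (leq_trans (size_polyD _ _)) // geq_max h.
- exact: leq_trans (size_scale_leq _ _) h.
- exact: leq_trans (size_nabla _ (leqnn _)) h'.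
Qed.

(* Transposing each operator onto the multiplier a leaves only total derivatives. *)
Lemma Dgen_adjoint j k v : Dgen s f j k v -> forall a : A,
  exists (c : A) (B : 'I_n -> V) (w : V), [/\ forall l, (size (B l) <= k)%N, (size w <= k)%N &
    a *: v = c *: 'X^j + \sum_l nab l (B l) + (f *: 'X - 1) * w].
Proof.
elim=> [h|w h|u w _ IHu _ IHw|p u _ IH|l u hu IH h] a.
- exists a, (fun=> 0), 0; split; rewrite ?size_poly0 // mulr0 addr0.
  by rewrite big1 ?addr0 // => l _; rewrite nabla0.
- exists 0, (fun=> 0), (a *: w); split; rewrite ?size_poly0 //.
    by rewrite (leq_trans (size_scale_leq _ _)) // ltnW.
  rewrite big1 => [|l _]; last by rewrite nabla0.
  by rewrite scale0r !add0r scalerAr.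
- have [c [B [x [hB hx e]]]] := IHu a; have [c' [B' [x' [hB' hx' e']]]] := IHw a.
  exists (c + c'), (fun l => B l + B' l), (x + x'); split.
  + by move=> l; rewrite (leq_trans (size_polyD _ _)) // geq_max hB hB'.
  + by rewrite (leq_trans (size_polyD _ _)) // geq_max hx hx'.
  under eq_bigr => l _ do rewrite nablaD.
  rewrite big_split scalerDr e e' /= scalerDl mulrDr.
  by rewrite addrACA; congr (_ + _); rewrite addrACA.
- by rewrite scalerA; apply: IH.
(* By Leibniz, a nabla_l u = nabla_l (a u) - (d_l a) u. The last term falls under the induction
   hypothesis, and a u joins the l-th derivative. *)
- have [c [B [x [hB hx e]]]] := IH (a^`M(l)).
  exists (- c), (fun m => - B m + (if m == l then a *: u else 0)), (- x); split.
  + move=> m; rewrite (leq_trans (size_polyD _ _)) // geq_max size_polyN hB /=.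
    by case: ifP => _; rewrite ?size_poly0 // (leq_trans (size_scale_leq _ _)) // ltnW.
  + by rewrite size_polyN.
  under eq_bigr => m _ do rewrite nablaD nablaN.
  rewrite big_split /= sumrN [X in _ + (- _ + X)](bigD1 l) //= eqxx [X in _ + (- _ + (_ + X))]big1 => [|m /negPf ->]; last by rewrite nabla0.
  rewrite nablaZ addr0 e mulrN scaleNr; ring.
Qed.

End FormalPoles.

(** * Degree bounds and derivatives of polynomials *)

Section Degrees.

Variables (n : nat).

Lemma msize_leP (R : nzRingType) (p : {mpoly R[n]}) k :
  (forall m, (k <= mdeg m)%N -> p@_m = 0) <-> (msize p <= k)%N.
Proof.
split=> [h|h m hm]; last by apply/memN_msupp_eq0/msize_mdeg_ge/(leq_trans h).
rewrite msizeE; apply/bigmax_leqP_seq => m hm _; rewrite ltnNge; apply/negP => /h e.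
by move: hm; rewrite mcoeff_msupp e eqxx.
Qed.

Lemma msizeD_leq (R : nzRingType) (p q : {mpoly R[n]}) k :
  (msize p <= k)%N -> (msize q <= k)%N -> (msize (p + q) <= k)%N.
Proof. by move=> hp hq; rewrite (leq_trans (mmeasureD_le _ _ _)) // geq_max hp. Qed.

Lemma msize_sum_leq (R : nzRingType) (I : Type) (r : seq I) (P : pred I)
    (F : I -> {mpoly R[n]}) k : (forall i, P i -> (msize (F i) <= k)%N) ->
  (msize (\sum_(i <- r | P i) F i)%R <= k)%N.
Proof.
move=> h; apply: (big_ind (fun p => (msize p <= k)%N)) => //; first by rewrite mmeasure0.
by move=> p q; apply: msizeD_leq.
Qed.

Lemma msizeM_leq (R : idomainType) (p q : {mpoly R[n]}) a b :
  (msize p <= a.+1)%N -> (msize q <= b.+1)%N -> (msize (p * q) <= (a + b).+1)%N.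
Proof.
have [->|hp] := eqVneq p 0; first by rewrite mul0r mmeasure0.
have [->|hq] := eqVneq q 0; first by rewrite mulr0 mmeasure0.
move=> ha hb; rewrite msizeM //; lia.
Qed.

Lemma msizeX_leq (R : idomainType) (p : {mpoly R[n]}) a k :
  (msize p <= a.+1)%N -> (msize (p ^+ k) <= (k * a).+1)%N.
Proof.
move=> ha; elim: k => [|k IH]; first by rewrite expr0 mmeasure1.
by rewrite exprS mulSn; apply: msizeM_leq.
Qed.

Lemma msize_mderiv (R : nzRingType) l (p : {mpoly R[n]}) k :
  (msize p <= k.+1)%N -> (msize (mderiv l p) <= k)%N.
Proof.
move=> /msize_leP h; apply/msize_leP => m hm.
by rewrite mcoeff_deriv h ?mul0rn // mdegD mdeg1 addn1 ltnS.
Qed.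

(** Characteristic zero in a form that passes to polynomial rings: symbols of operators have
    polynomial coefficients. *)
Definition torsion_free (R : nzRingType) := forall (x : R) k, x *+ k.+1 = 0 -> x = 0.

Lemma torsion_free_mpoly (R : nzRingType) : torsion_free R -> torsion_free {mpoly R[n]}.
Proof.
move=> h x k hx; apply/mpolyP => m; rewrite mcoeff0; apply: (h _ k).
by rewrite -mcoeffMn hx mcoeff0.
Qed.

(** If [m l] is positive, then [m l] times the coefficient of [p] at [m] is a coefficient of the
    l-th derivative. *)
Lemma mderiv_eq0_const (R : nzRingType) (p : {mpoly R[n]}) : torsion_free R ->
  (forall l, mderiv l p = 0) -> p = (p@_0)%:MP.
Proof.
move=> tR h; apply/mpolyP => m; rewrite mcoeffC.
have [->|hm] := eqVneq m 0%MM; first by rewrite mulr1.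
rewrite mulr0; have [l hl] : exists l, m l != 0%N.
  apply/existsP; apply: contra_neqT hm; rewrite negb_exists => /forallP hm.
  by apply/mnmP => l; rewrite mnm0E; apply/eqP; have := hm l; rewrite negbK.
apply: (tR _ (m l).-1); have /(congr1 (mcoeff (m - U_(l))%MM)) := h l.
rewrite mcoeff0 mcoeff_deriv mnmBE mnm1E eqxx subn1 => <-; congr (p@_ _ *+ _).
apply/mnmP => i; rewrite mnmDE mnmBE mnm1E subnK //.
by case: eqP => // <-; rewrite lt0n.
Qed.

End Degrees.

Lemma torsion_free_field (E : fieldType) : [pchar E] =i pred0 -> torsion_free E.
Proof.
move=> hE x k /eqP; rewrite -mulr_natr mulf_eq0 => /orP [/eqP //|].
by move: hE => /pcharf0P ->.
Qed.

(** * Normally ordered operators and their symbols *)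

Section NormalOrdering.

Variables (R : comNzRingType) (n : nat) (s : R) (f : {mpoly R[n]}).
Local Notation A := {mpoly R[n]}.
Local Notation V := {poly A}.
Local Notation nab := (nabla s f).

(** The list [r] fixes the order of the factors and is what inductions run over; the full operator
    has [r = enum 'I_n]. *)
Definition nablas (r : seq 'I_n) (m : 'X_{1..n}) (v : V) : V :=
  foldr (fun l => iter (m l) (nab l)) v r.

Lemma nabla_iterD l b : {morph iter b (nab l) : u v / u + v}.
Proof. by elim: b => [//|b IH] u v; rewrite !iterS IH nablaD. Qed.

Lemma nabla_iterMn l b v k : iter b (nab l) (v *+ k) = iter b (nab l) v *+ k.
Proof.
elim: k => [|k IH]; last by rewrite !mulrS nabla_iterD IH.
by rewrite !mulr0n; elim: b => [//|b IH]; rewrite iterS IH nabla0.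
Qed.

Lemma nabla_iterXr l m b v : l != m ->
  iter b (nab l) ('X_m *: v) = 'X_m *: iter b (nab l) v.
Proof. by move=> h; elim: b => [//|b IH]; rewrite !iterS IH nablaXr. Qed.

Lemma nabla_iterXl l b v : iter b (nab l) ('X_l *: v) =
  'X_l *: iter b (nab l) v + iter b.-1 (nab l) v *+ b.
Proof.
elim: b => [|b IH]; first by rewrite /= mulr0n addr0.
rewrite iterS IH nablaD nablaXl (nabla_iterMn l 1 _ b : nab l _ = _) /=.
rewrite -addrA addrCA mulrS; congr (_ + (_ + _)).
by case: b {IH} => [|b]; rewrite ?mulr0n.
Qed.

Lemma nablas_notin r m l v : l \notin r -> nablas r (m - U_(l))%MM v = nablas r m v.
Proof.
elim: r => [//|i r IH]; rewrite inE negb_or => /andP [hi /IH] /= ->.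
by rewrite mnmBE mnm1E (negPf hi) subn0.
Qed.

(** Moving x_l to the left past nabla_l^(m l) leaves [m l] times one power less; the other factors
    commute with x_l. *)
Lemma nablas_X r m l v : uniq r -> nablas r m ('X_l *: v) =
  'X_l *: nablas r m v + (if l \in r then nablas r (m - U_(l))%MM v *+ m l else 0).
Proof.
elim: r => [_|i r IH /=]; first by rewrite addr0.
move=> /andP [hi /IH ->]; rewrite inE; have [->|hil] := eqVneq l i.
  rewrite (negPf hi) addr0 nabla_iterXl /= nablas_notin // mnmBE mnm1E eqxx.
  by rewrite subn1.
rewrite nabla_iterD nabla_iterXr; last by rewrite eq_sym.
rewrite /= mnmBE mnm1E (negPf hil) subn0; congr (_ + _).
case: ifP => _; first by rewrite nabla_iterMn.
by rewrite -[X in iter _ _ X](mulr0n (0 : V)) nabla_iterMn mulr0n.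
Qed.

(** The operator with symbol [c]: the outer variables of [c] stand for the nabla_l, and multipliers
    from [A] stand to their left. *)
Definition wop (c : {mpoly A[n]}) (v : V) : V :=
  \sum_(m <- msupp c) c@_m *: nablas (enum 'I_n) m v.

Lemma nablasD r m : {morph nablas r m : u v / u + v}.
Proof. by elim: r => [//|l r IH] u v; rewrite /= IH nabla_iterD. Qed.

Lemma nablas_constZ r m (a : R) v : nablas r m (a%:MP *: v) = a%:MP *: nablas r m v.
Proof.
elim: r => [//|l r IH] /=; rewrite IH; elim: (m l) => [//|b IHb].
by rewrite !iterS IHb nablaZ mderivC scale0r add0r.
Qed.

Lemma wopDr c : {morph wop c : u v / u + v}.
Proof. by move=> u v; rewrite /wop -big_split; apply: eq_bigr => m _; rewrite nablasD scalerDr. Qed.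

Lemma wop_constZ c (a : R) v : wop c (a%:MP *: v) = a%:MP *: wop c v.
Proof.
rewrite /wop scaler_sumr; apply: eq_bigr => m _.
by rewrite nablas_constZ !scalerA mulrC.
Qed.

Lemma wop0r c : wop c 0 = 0.
Proof. by rewrite -[X in wop c X](scale0r (0 : V)) -mpolyC0 wop_constZ mpolyC0 scale0r. Qed.

Lemma wop_widen c v k : (msize c <= k)%N ->
  wop c v = \sum_(m : 'X_{1..n < k}) c@_m *: nablas (enum 'I_n) m v.
Proof.
move=> hk; set I : subFinType _ := 'X_{1..n < k}.
rewrite /wop (big_mksub I) ?msupp_uniq //=; first last.
  by move=> x /msize_mdeg_lt /leq_trans; apply.
by rewrite big_rmcond //= => j /memN_msupp_eq0 ->; rewrite scale0r.
Qed.

Lemma wopDl v : {morph wop^~ v : c c' / c + c'}.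
Proof.
move=> c c' /=; pose k := maxn (msize c) (msize c').
rewrite !(@wop_widen _ v k) ?msizeD_leq ?leq_maxl ?leq_maxr // -big_split.
by apply: eq_bigr => m _; rewrite mcoeffD scalerDl.
Qed.

Lemma wop0l v : wop 0 v = 0.
Proof. by rewrite /wop msupp0 big_nil. Qed.

Lemma wop_monomial p m v : wop (p *: 'X_[m]) v = p *: nablas (enum 'I_n) m v.
Proof.
have [->|hp] := eqVneq p 0; first by rewrite !scale0r wop0l.
by rewrite /wop msuppMCX // big_seq1 mcoeffZ mcoeffX eqxx mulr1.
Qed.

Lemma wop_const p v : wop p%:MP v = p *: v.
Proof.
rewrite -[p%:MP]mulr1 mul_mpolyC -mpolyX0 wop_monomial; congr (_ *: _).
by rewrite /nablas; elim: (enum _) => //= l r ->; rewrite mnm0E.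
Qed.

Lemma wop_sum (I : Type) (r : seq I) (F : I -> {mpoly A[n]}) v :
  wop (\sum_(i <- r) F i) v = \sum_(i <- r) wop (F i) v.
Proof. exact: (big_morph (wop^~ v) (wopDl v) (wop0l v)). Qed.

(* The commutator of an operator with x_l is its symbol's derivative in xi_l. *)
Lemma wop_X c l v : wop c ('X_l *: v) = 'X_l *: wop c v + wop (mderiv l c) v.
Proof.
elim/mpolyind: c => [|p m c _ _ IH].
  by rewrite mderiv0 !wop0l scaler0 addr0.
rewrite mderivD !wopDl IH scalerDr addrACA; congr (_ + _).
rewrite mderivZ mderivX scalerA !wop_monomial nablas_X ?enum_uniq // mem_enum /=.
by rewrite scalerDr !scalerA mulrC -scaler_nat scalerA.
Qed.

End NormalOrdering.

(** * Bernstein's inequality and the functional equation *)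

Section Bernstein.

Variables (E : fieldType) (charE : [pchar E] =i pred0) (n : nat) (s : E).
Local Notation A := {mpoly E[n]}.
Local Notation V := {poly A}.
Variables (f : A) (d : nat) (hf : (msize f <= d.+1)%N).
Local Notation nab := (nabla s f).

(** Submodules over the Weyl algebra, with d_l acting as [nab l]. *)
Definition dstable (N : V -> Prop) :=
  [/\ N 0, forall u w, N u -> N w -> N (u + w),
      forall (p : A) u, N u -> N (p *: u) & forall l u, N u -> N (nab l u)].

Lemma dstable_sum (N : V -> Prop) (I : Type) (r : seq I) (P : pred I) (F : I -> V) :
  dstable N -> (forall i, P i -> N (F i)) -> N (\sum_(i <- r | P i) F i).
Proof. by move=> [N0 ND _ _] h; apply: big_ind. Qed.

(** Compatibility with the Bernstein filtration, in which each x_l and each nabla_l has degree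
    one. *)
Definition dfiltration (G : nat -> V -> Prop) :=
  [/\ forall k v, G k v -> G k.+1 v, forall l k v, G k v -> G k.+1 ('X_l *: v)
    & forall l k v, G k v -> G k.+1 (nab l v)].

(** Commuting with x_l replaces the symbol by its l-th derivative at the cost of one filtration
    level. At most [m] such steps reach a nonzero constant symbol, which acts as multiplication by a
    polynomial. *)
Lemma wop_descent (N : V -> Prop) (G : nat -> V -> Prop) b m (c : {mpoly A[n]}) k :
  dstable N -> dfiltration G -> c != 0 -> (msize c <= m.+1)%N ->
  (forall i, (msize c@_i <= b)%N) -> (forall v, G (k + m)%N v -> N (wop s f c v)) ->
  exists p : A, [/\ p != 0, (msize p <= b)%N & forall v, G k v -> N (p *: v)].
Proof.
move=> [_ ND NZ _] [G1 GX _]; have tA := torsion_free_mpoly (n := n) (torsion_free_field charE).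
have const c' j : c' = (c'@_0)%:MP -> c' != 0 -> (forall i, (msize c'@_i <= b)%N) ->
    (forall v, G (k + j)%N v -> N (wop s f c' v)) ->
    exists p : A, [/\ p != 0, (msize p <= b)%N & forall v, G k v -> N (p *: v)].
  move=> ec nz hb hN; exists (c'@_0); split=> // [|v hv].
    by apply: contra_neq nz => e; rewrite ec e mpolyC0.
  rewrite -(wop_const s f) -ec; apply: hN.
  by elim: j => [|j IH]; rewrite ?addn0 // addnS; apply: G1.
elim: m c => [|m IH] c nz hm hb hN; first by apply: (const c 0%N) => //; apply: msize1_polyC.
have [/existsP [l hl]|/existsPn h] := boolP [exists l, mderiv l c != 0]; last first.
  apply: (const c m.+1) => //; apply: mderiv_eq0_const => // l.
  by apply/eqP; rewrite -[_ == _]negbK h.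
apply: (IH (mderiv l c)) => // [|i|v hv]; first exact: msize_mderiv.
  rewrite mcoeff_deriv; apply/msize_leP => j hj; rewrite mcoeffMn.
  by move/msize_leP : (hb (i + U_(l))%MM) => -> //; rewrite mul0rn.
have -> : wop s f (mderiv l c) v = wop s f c ('X_l *: v) + (- 'X_l) *: wop s f c v.
  by rewrite wop_X scaleNr addrAC subrr add0r.
by rewrite addnS in hN; apply: ND; [|apply: NZ]; apply: hN; [apply: GX|apply: G1].
Qed.

(** The same descent on the degree of [p], by the commutators [nabla_l, p] = d_l p. It ends at a
    nonzero scalar, which is invertible. *)
Lemma multiplier_descent (N : V -> Prop) (G : nat -> V -> Prop) b (p : A) k :
  dstable N -> dfiltration G -> p != 0 -> (msize p <= b.+1)%N ->
  (forall v, G (k + b)%N v -> N (p *: v)) -> forall v, G k v -> N v.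
Proof.
move=> [_ ND NZ Nn] [G1 _ Gn]; have tE := torsion_free_field charE.
have const p' j : p' = (p'@_0)%:MP -> p' != 0 ->
    (forall v, G (k + j)%N v -> N (p' *: v)) -> forall v, G k v -> N v.
  move=> ep nz hN v hv; have nz0 : p'@_0 != 0.
    by apply: contra_neq nz => e; rewrite ep e mpolyC0.
  have {}hN : N (p' *: v).
    by apply: hN; elim: j => [|j IH]; rewrite ?addn0 // addnS; apply: G1.
  by have := NZ ((p'@_0)^-1)%:MP _ hN; rewrite scalerA ep mcoeffC eqxx mulr1 -mpolyCM mulVf // scale1r.
elim: b p => [|b IH] p nz hb hN; first by apply: (const p 0%N) => //; apply: msize1_polyC.
have [/existsP [l hl]|/existsPn h] := boolP [exists l, mderiv l p != 0]; last first.
  apply: (const p b.+1) => //; apply: mderiv_eq0_const => // l.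
  by apply/eqP; rewrite -[_ == _]negbK h.
apply: (IH (mderiv l p)) => // [|v hv]; first exact: msize_mderiv.
have -> : mderiv l p *: v = nab l (p *: v) + (- 1) *: (p *: nab l v).
  by rewrite nablaZ scaleN1r addrK.
by rewrite addnS in hN; apply: ND; [apply: Nn|apply: NZ]; apply: hN; [apply: G1|apply: Gn].
Qed.

Lemma iter_filtration (G : nat -> V -> Prop) l b k v : dfiltration G ->
  G k v -> G (k + b)%N (iter b (nab l) v).
Proof.
by move=> [_ _ h] hv; elim: b => [|b IH]; rewrite ?addn0 // addnS; apply: h.
Qed.

Lemma nablas_filtration (G : nat -> V -> Prop) m k v : dfiltration G -> G k v ->
  G (k + mdeg m)%N (nablas s f (enum 'I_n) m v).
Proof.
move=> hG hv; rewrite mdegE -big_enum /=; elim: (enum _) => [|l r IH] /=.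
  by rewrite big_nil addn0.
by rewrite big_cons addnCA addnC; apply: iter_filtration.
Qed.

Lemma monomial_filtration (G : nat -> V -> Prop) m k v : dfiltration G -> G k v ->
  G (k + mdeg m)%N ('X_[m] *: v).
Proof.
move=> [_ h _] hv; rewrite mpolyXE_id mdegE.
elim/big_rec2: _ => [|l p a _ IH]; first by rewrite addn0 scale1r.
rewrite addnCA addnC -scalerA; elim: (m l) => [|b IHb].
  by rewrite expr0 scale1r addn0.
by rewrite exprS -scalerA addnS; apply: h.
Qed.

Lemma dstable_wop (N : V -> Prop) c v : dstable N -> N v -> N (wop s f c v).
Proof.
move=> [N0 ND NZ Nn] hv; apply: (big_ind N) => // m _; apply: NZ.
elim: (enum _) => [//|l r IH] /=; elim: (m l) => [//|b IHb].
by rewrite iterS; apply: Nn.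
Qed.

(* If no h^n elements of G_{4nh} were independent modulo N, then the h^(2n) operators
   x^a nabla^b with all exponents < h would satisfy a relation modulo N on G_{2nh}. *)
Lemma bernstein_inequality (N : V -> Prop) (G : nat -> V -> Prop) h :
  dstable N -> dfiltration G -> (forall k, subspace (@mpolyC n E) (G k)) ->
  (forall v, (forall i, G (4 * n * h)%N (v i)) -> ~ indep_mod (@mpolyC n E) N (h ^ n) v) ->
  forall v, G 0%N v -> N v.
Proof.
move=> hN hG hGs hind; have [N0 ND NZ Nn] := hN; have [G1 _ _] := hG.
have hNs : subspace (@mpolyC n E) N.
  by split=> // a u w hu hw; apply: ND => //; apply: NZ.
have Gmono k k' v : (k <= k')%N -> G k v -> G k' v.
  by elim: k' => [|k' IH]; rewrite leq_eqVlt => /orP [/eqP <- //|//] /IH e /e; apply: G1.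
(* Spanning families modulo [N]: [b] for level 4nh and [b'] for level 2nh, each with fewer than h^n
   members. *)
have [g [b [hg _ hb]]] := subspace_spanned hNs (hGs _) hind.
have [v hv|g' [b' [hg' Gb' hb']]] := @subspace_spanned _ _ _ _ N (G (2 * n * h)%N) (h ^ n) hNs (hGs _).
  by apply: hind => i; apply: Gmono (hv i); lia.
pose I : finType := {ffun 'I_n -> 'I_h}; pose mon (x : I) := [multinom (x l : nat) | l < n].
have mon_inj : injective mon.
  move=> x y /mnmP e; apply/ffunP => l; apply: val_inj.
  by have := e l; rewrite !mnmE.
have mdeg_mon x : (mdeg (mon x) <= n * h)%N.
  rewrite mdegE -[X in (_ <= X * _)%N]card_ord -sum_nat_const.
  by apply: leq_sum => l _; rewrite mnmE ltnW.
have cardI : #|I| = (h ^ n)%N by rewrite card_ffun !card_ord.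
pose T (x y : I) v := ('X_[mon x] : A) *: nablas s f (enum 'I_n) (mon y) v.
have GT x y k v : G k v -> G (k + 2 * n * h)%N (T x y v).
  move=> hv; have := monomial_filtration (mon x) hG (nablas_filtration (mon y) hG hv).
  by apply: Gmono; have := mdeg_mon x; have := mdeg_mon y; lia.
(* Each [T x y] raises the level by at most 2nh, so the images of the [b'] are combinations of the
   [b] modulo [N]; [M] holds the coordinates. *)
have /fin_all_exists [M hM] : forall i : I * I * 'I_g', exists a : nat -> E,
    N (T i.1.1 i.1.2 (b' i.2) - \sum_(j < g) (a j)%:MP *: b j).
  by move=> i; apply: hb; apply: Gmono (GT _ _ _ _ (Gb' _)); lia.
(* There are h^(2n) unknown coefficients but only g' g < h^(2n) equations. *)
have [|c [[x y] /= nz] hc] := @wide_kernel E (I * I)%type ('I_g' * 'I_g)%type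
    (fun i j => M (i, j.1) j.2).
  by rewrite !card_prod cardI !card_ord; apply: ltn_mul.
pose C : {mpoly A[n]} := \sum_(y' : I) (\sum_(x' : I) (c (x', y'))%:MP * 'X_[mon x']) *: 'X_[mon y'].
have coefC y' : C@_(mon y') = \sum_(x' : I) (c (x', y'))%:MP * 'X_[mon x'].
  rewrite raddf_sum (bigD1 y') //= mcoeffZ mcoeffX eqxx mulr1 [X in _ + X]big1 ?addr0 // => z hz.
  by rewrite mcoeffZ mcoeffX (inj_eq mon_inj) (negPf hz) mulr0.
have nzC : C != 0.
  apply: contra_neq nz => e; have := coefC y; rewrite e mcoeff0.
  move/(congr1 (mcoeff (mon x))); rewrite mcoeff0 raddf_sum (bigD1 x) //=.
  rewrite mcoeffCM mcoeffX eqxx mulr1 [X in _ + X]big1 ?addr0 // => z hz.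
  by rewrite mcoeffCM mcoeffX (inj_eq mon_inj) (negPf hz) mulr0.
have msC : (msize C <= (n * h).+1)%N.
  apply: msize_sum_leq => z _; apply: leq_trans (msizeZ_le _ _) _.
  by rewrite msizeX ltnS.
have msCc i : (msize C@_i <= (n * h).+1)%N.
  rewrite raddf_sum; apply: msize_sum_leq => z _ /=; rewrite mcoeffZ mcoeffX.
  rewrite mulr_natr; case: eqP => _; last by rewrite mulr0n mmeasure0.
  rewrite mulr1n; apply: msize_sum_leq => w _; rewrite mul_mpolyC.
  by apply: leq_trans (msizeZ_le _ _) _; rewrite msizeX ltnS.
have wopC v : wop s f C v = \sum_(i : I * I) (c i)%:MP *: T i.1 i.2 v.
  rewrite wop_sum (eq_bigr (fun y' => \sum_(x' : I) (c (x', y'))%:MP *: T x' y' v)).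
    rewrite exchange_big pair_bigA /=; apply: eq_bigr => -[x' y'] _ //.
  move=> y' _; rewrite wop_monomial scaler_suml.
  by apply: eq_bigr => x' _; rewrite scalerA.
have Nb' (i : 'I_g') : N (wop s f C (b' i)).
  have -> : wop s f C (b' i) = \sum_(j : I * I) (c j)%:MP *:
      (T j.1 j.2 (b' i) - \sum_(l < g) (M (j, i) l)%:MP *: b l); last first.
    by apply: dstable_sum => // j _; apply: NZ; apply: (hM (j, i)).
  rewrite wopC; under [RHS]eq_bigr => j _ do rewrite scalerBr scaler_sumr.
  rewrite sumrB [X in _ = _ - X]exchange_big /= [X in _ = _ - X]big1 ?subr0 // => l _.
  under eq_bigr => j _ do rewrite scalerA -mpolyCM.
  by rewrite -scaler_suml -raddf_sum (hc (i, l)) raddf0 scale0r.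
have NC v : G (n * h + n * h)%N v -> N (wop s f C v).
  move=> hv; have [|a ha] := hb' v; first by apply: Gmono hv; lia.
  rewrite -[v](subrK (\sum_(i < g') (a i)%:MP *: b' i)) wopDr; apply: ND.
    exact: dstable_wop.
  rewrite (big_morph _ (wopDr s f C) (wop0r s f C)).
  by apply: dstable_sum => // i _; rewrite wop_constZ; apply: NZ.
(* The operator [C] maps level 2nh into [N]. Each of the two descents costs nh levels, from 2nh to
   nh and then to 0. *)
have [p [nzp mp hp]] := wop_descent hN hG nzC msC msCc NC.
exact: (multiplier_descent (k := 0) hN hG nzp mp hp).
Qed.

(** The D-module generated by the symbol of f^(s-j), taken together with all multiples of the
    relation [f *: 'X - 1]. *)
Definition Dmod j (v : V) := exists k, Dgen s f j k v.

Lemma Dmod_stable j : dstable (Dmod j).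
Proof.
split=> [|u w [k hu] [k' hw]|p u [k hu]|l u [k hu]].
- by exists j.+1; rewrite -[0](scale0r ('X^j : V)); apply/Dgen_scale/Dgen_base.
- by exists (maxn k k'); apply: Dgen_add; [apply: Dgen_mono hu|apply: Dgen_mono hw];
    rewrite ?leq_maxl ?leq_maxr.
- by exists k; apply: Dgen_scale.
- by exists k.+1; apply: Dgen_nabla; [apply: Dgen_mono hu|apply: size_Dgen hu].
Qed.

Lemma Dmod_rel j w : Dmod j ((f *: 'X - 1) * w).
Proof. by exists (size w).+1; apply: Dgen_rel. Qed.

Lemma Dmod_base j : Dmod j 'X^j.
Proof. by exists j.+1; apply: Dgen_base. Qed.

(** Modulo the relation, f^(s-j) = f f^(s-j-1), so the old generator lies in the new module. *)
Lemma DmodS j v : Dmod j v -> Dmod j.+1 v.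
Proof.
have [N0 ND NZ Nn] := Dmod_stable j.+1.
case=> k; elim=> [_|w _|u w _ hu _ hw|p u _ hu|l u _ hu _].
- have -> : 'X^j = f *: 'X^(j.+1) + (- 1) *: ((f *: 'X - 1) * 'X^j) :> V.
    by rewrite scaleN1r mulrBl mul1r -scalerAl -exprS opprB addrC subrK.
  by apply: ND; apply: NZ; [apply: Dmod_base|apply: Dmod_rel].
- exact: Dmod_rel.
- exact: ND.
- exact: NZ.
- exact: Nn.
Qed.

Lemma dstable_subspace N : dstable N -> subspace (@mpolyC n E) N.
Proof. by case=> N0 ND NZ _; split=> // a u w hu hw; apply: ND => //; apply: NZ. Qed.

(** A filtration of [Dmod j] by pole order and degree of numerators. The rate [d.+1] covers both
    x_l, which adds 1 to the degree, and nabla_l, which adds at most the degree of the partials of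
    [f]. *)
Definition Gam j k (v : V) :=
  [/\ Dmod j v, (size v <= (j + k).+1)%N & forall i, (msize v`_i <= (k * d.+1).+1)%N].

Lemma Gam_subspace j k : subspace (@mpolyC n E) (Gam j k).
Proof.
have [N0 ND NZ _] := Dmod_stable j; split=> [|a u w [hu su mu] [hw sw mw]].
  by split=> // [|i]; rewrite ?size_poly0 // coef0 mmeasure0.
split=> [||i]; first by apply: ND => //; apply: NZ.
  by rewrite (leq_trans (size_polyD _ _)) // geq_max sw (leq_trans (size_scale_leq _ _)).
rewrite coefD coefZ mul_mpolyC; apply: msizeD_leq => //.
exact: leq_trans (msizeZ_le _ _) _.
Qed.

Lemma Gam_filtration j : dfiltration (Gam j).
Proof.
have [N0 ND NZ Nn] := Dmod_stable j.
split=> [k v [hv sv mv]|l k v [hv sv mv]|l k v [hv sv mv]].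
- split=> // [|i]; first by rewrite addnS ltnW.
  by apply: leq_trans (mv i) _; rewrite ltnS leq_mul2r leqnSn orbT.
- split=> [||i]; first exact: NZ.
    by rewrite addnS ltnW // ltnS (leq_trans (size_scale_leq _ _)).
  rewrite coefZ; apply: leq_trans (msizeM_leq (a := 1) _ (mv i)) _.
    by rewrite msizeX mdeg1.
  by rewrite ltnS mulSn leq_add2r.
split=> [||i]; first exact: Nn.
  by rewrite addnS; apply: size_nabla.
rewrite coef_nabla; apply: msizeD_leq.
  apply: leq_trans (msize_mderiv _ (mv i)) _.
  by rewrite mulSn -addnS; apply: leq_trans (leq_addl _ _); rewrite leqnSn.
case: i => [|i]; first by rewrite mmeasure0.
have h1 : (msize (s%:MP - i%:R : A) <= 1)%N.
  by rewrite -mpolyC_nat -mpolyCB mmeasureC leq_b1.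
apply: leq_trans (msizeM_leq (b := d) (msizeM_leq (a := 0) h1 (mv i)) _) _.
  by apply: msize_mderiv; apply: leq_trans hf _.
by rewrite ltnS add0n mulSn addnC leq_add2r.
Qed.

Definition clear_poles Q (v : V) : A := \sum_(i < Q.+1) v`_i * f ^+ (Q - i).

(** By the geometric sum, X^i and f^(Q-i) X^Q differ by a multiple of f X - 1. *)
Lemma clear_polesP Q (v : V) : (size v <= Q.+1)%N ->
  exists w, v = clear_poles Q v *: 'X^Q + (f *: 'X - 1) * w.
Proof.
move=> hv.
exists (- \sum_(i < Q.+1) v`_i *: ('X^i * \sum_(t < Q - i) (f *: 'X) ^+ t)).
rewrite mulrN mulr_sumr -sumrN scaler_suml -big_split /=.
transitivity (\sum_(i < Q.+1) v`_i *: 'X^i).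
  rewrite -poly_def; apply/polyP => i; rewrite coef_poly; case: ltnP => // hi.
  by rewrite nth_default // (leq_trans hv).
apply: eq_bigr => i _; rewrite -scalerAr mulrCA -subrX1 exprZn mulrBr mulr1 -scalerAr -exprD.
by rewrite subnKC -1?ltnS // scalerBr scalerA opprB addrC subrK.
Qed.

Lemma bernstein_sato : exists j k, Dgen s f j k ('X^(j.+1) : V).
Proof.
apply: NNPP => hno.
(* With this [c] the bound [D.+1 <= h * c] below holds, and h > c^n gives (h c)^n < h^(n+1). *)
pose c := (4 * n * d.+1 + (1 + 4 * n) * d).+1; pose h := (c ^ n).+1.
have hv j : exists v : nat -> V, (forall i, Gam j.+1 (4 * n * h) (v i)) /\
    indep_mod (@mpolyC n E) (Dmod j) (h ^ n) v.
  (* Without such a family Bernstein's inequality would put ['X^(j.+1)], which lies in level 0 of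
     [Gam j.+1], into [Dmod j]. *)
  apply: NNPP => hv; apply: hno.
  have [k hk] : Dmod j 'X^(j.+1); last by exists j, k.
  apply: (@bernstein_inequality (Dmod j) (Gam j.+1) h) => //.
  - exact: Dmod_stable.
  - exact: Gam_filtration.
  - exact: Gam_subspace.
  - by move=> v h1 h2; apply: hv; exists v.
  split=> [||i]; first exact: Dmod_base; rewrite ?size_polyXn ?addn0 // coefXn.
  by case: eqP => _; rewrite ?mmeasure0 ?mmeasure1.
pose w j := proj1_sig (constructive_indefinite_description _ (hv j)).
have wG j i : Gam j.+1 (4 * n * h) (w j i).
  by rewrite /w; case: constructive_indefinite_description => v [].
have wi j : indep_mod (@mpolyC n E) (Dmod j) (h ^ n) (w j).
  by rewrite /w; case: constructive_indefinite_description => v [].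
(* As j + 1 <= h, [Q] bounds the formal pole orders of all the [w j i], and [D] bounds the degrees
   of their numerators over order [Q]. *)
pose Q := (h + 4 * n * h)%N; pose D := (4 * n * h * d.+1 + Q * d)%N.
have hD : (D.+1 <= h * c)%N by rewrite /D /Q /c; nia.
have ws (j : 'I_h) i : (size (w j i) <= Q.+1)%N.
  by have [_ sw _] := wG j i; apply: leq_trans sw _; rewrite ltnS leq_add2r.
have wm j i : (msize (clear_poles Q (w j i)) <= D.+1)%N.
  have [_ _ mw] := wG j i; apply: msize_sum_leq => t _.
  apply: leq_trans (msizeM_leq (mw t) (msizeX_leq _ hf)) _.
  by rewrite ltnS leq_add2l leq_mul2r leq_subr orbT.
pose J : finType := {ffun 'I_n -> 'I_D.+1}; pose mon (x : J) := [multinom (x l : nat) | l < n].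
(* There are h^(n+1) vectors but only (D+1)^n monomials with exponents up to [D], so a nontrivial
   combination has zero numerator. *)
have [|a [[j0 i0] nz] ha] := @wide_kernel E ('I_h * 'I_(h ^ n))%type J
    (fun i x => (clear_poles Q (w i.1 i.2))@_(mon x)).
  rewrite card_prod card_ffun !card_ord; apply: leq_ltn_trans (_ : (h * c) ^ n < _)%N.
    by case: (n) => // n'; rewrite leq_exp2r.
  by rewrite expnMn mulnC ltn_pmul2r // expn_gt0.
pose a' j i := if (insub j, insub i) is (Some x, Some y) then a (x, y) else 0.
have ea' (x : 'I_h * 'I_(h ^ n)) : a' x.1 x.2 = a x by case: x => x y; rewrite /a' !valK.
pose u := \sum_(j < h) \sum_(i < h ^ n) (a' j i)%:MP *: w j i : V.
have su : (size u <= Q.+1)%N.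
  apply: leq_trans (size_sum _ _ _) _; apply/bigmax_leqP => j _.
  apply: leq_trans (size_sum _ _ _) _; apply/bigmax_leqP => i _.
  exact: leq_trans (size_scale_leq _ _) (ws _ _).
have cu : clear_poles Q u = \sum_x (a x)%:MP * clear_poles Q (w x.1 x.2).
  rewrite /clear_poles; under [RHS]eq_bigr => x _ do rewrite mulr_sumr.
  rewrite exchange_big; apply: eq_bigr => t _ /=.
  rewrite /u pair_bigA /= coef_sum mulr_suml.
  by apply: eq_bigr => x _; rewrite coefZ mulrA ea'.
have {cu} cu0 : clear_poles Q u = 0.
  apply/mpolyP => m; rewrite mcoeff0 cu raddf_sum /=.
  under eq_bigr => x _ do rewrite mcoeffCM.
  have [/forallP hm|/forallPn [l]] := boolP [forall l, (m l <= D)%N].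
    pose y : J := [ffun l => inord (m l)].
    have -> : m = mon y by apply/mnmP => l; rewrite mnmE ffunE inordK // ltnS.
    exact: ha.
  rewrite -ltnNge => hl; apply: big1 => x _; move/msize_leP: (wm x.1 x.2) => ->.
    by rewrite mulr0.
  by apply: leq_trans hl _; rewrite mdegE (bigD1 l) //= leq_addr.
(* With zero numerator, [u] is a multiple of the relation, hence in [Dmod 0]; triangularity then
   kills all its coefficients. *)
have Du : Dmod 0 u.
  have [t ->] := clear_polesP su; rewrite cu0 scale0r add0r; exact: Dmod_rel.
have := @indep_mod_triangular E A (@mpolyC n E) V Dmod (h ^ n) w
  (fun j => dstable_subspace (Dmod_stable j)) DmodS (fun j i => let: And3 k _ _ := wG j i in k) wi h a' Du.
move=> /(_ j0 i0 (ltn_ord _) (ltn_ord _)); rewrite (ea' (j0, i0)) => e.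
by rewrite e eqxx in nz.
Qed.

End Bernstein.

(** * Change of scalars in the formal relations *)

Section BaseChange.

Variables (R R' : comNzRingType) (g : {rmorphism R -> R'}) (n : nat).
Local Notation "v ^g" := (map_poly (map_mpoly (n := n) g) v) (at level 2, format "v ^g").

Lemma map_mpoly_mderiv l (p : {mpoly R[n]}) :
  map_mpoly g (mderiv l p) = mderiv l (map_mpoly g p).
Proof. by apply/mpolyP => m; rewrite mcoeff_deriv !mcoeff_map_mpoly mcoeff_deriv raddfMn. Qed.

Lemma map_nabla s (f : {mpoly R[n]}) l v :
  (nabla s f l v)^g = nabla (g s) (map_mpoly g f) l v^g.
Proof.
apply/polyP => i; rewrite coef_nabla !coef_map /= coef_nabla. rewrite rmorphD /= map_mpoly_mderiv.
congr (_ + _); case: i => [|i]; first by rewrite rmorph0.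
by rewrite !rmorphM rmorphB rmorph_nat coef_map /= map_mpolyC map_mpoly_mderiv.
Qed.

Lemma map_rel (f : {mpoly R[n]}) w :
  ((f *: 'X - 1) * w)^g = (map_mpoly g f *: 'X - 1) * w^g.
Proof. by rewrite rmorphM rmorphB rmorph1 /= map_polyZ map_polyX. Qed.

Lemma map_Dgen s (f : {mpoly R[n]}) j k v :
  Dgen s f j k v -> Dgen (g s) (map_mpoly g f) j k v^g.
Proof.
elim=> [h|w h|u w _ hu _ hw|p u _ hu|l u _ hu h].
- by rewrite map_polyXn; apply: Dgen_base.
- by rewrite map_rel; apply: Dgen_rel; apply: leq_ltn_trans h; apply: size_poly.
- by rewrite rmorphD; apply: Dgen_add.
- by rewrite map_polyZ; apply: Dgen_scale.
- by rewrite map_nabla; apply: Dgen_nabla => //; apply: leq_ltn_trans h; apply: size_poly.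
Qed.

End BaseChange.

(** * Clearing denominators in the scalars *)

Section ClearDenominators.

Variables (R : idomainType) (n : nat).
Local Notation "x %:F" := (@FracField.tofrac R x) : ring_scope.
Local Notation tf := (@FracField.tofrac R).
Local Notation E := {fraction R}.
Local Notation tfm := (map_mpoly (n := n) tf).

Lemma clear_mpoly (p : {mpoly E[n]}) : exists2 b, b != 0 & exists q, tfm q = b%:F *: p.
Proof.
elim/mpolyind: p => [|x m p _ _ [b nzb [q hq]]].
  by exists 1; rewrite ?oner_neq0 //; exists 0; rewrite rmorph0 scaler0.
exists (rden x * b); first by rewrite mulf_neq0 ?rden_neq0.
exists ((rnum x * b) *: 'X_[m] + rden x *: q).
rewrite rmorphD /= !map_mpolyZ map_mpolyX hq scalerDr !scalerA !rmorphM /=.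
congr (_ *: _ + _); rewrite {3}[x]fracE mulrAC; congr (_ * _).
by rewrite mulrC divfK // tofrac_eq0 rden_neq0.
Qed.

Lemma clear_poly (v : {poly {mpoly E[n]}}) : exists2 b, b != 0 &
  exists w, map_poly tfm w = (b%:F)%:MP *: v.
Proof.
elim/poly_ind: v => [|v p [b nzb [w hw]]].
  by exists 1; rewrite ?oner_neq0 //; exists 0; rewrite rmorph0 scaler0.
have [c nzc [q hq]] := clear_mpoly p.
exists (b * c); first by rewrite mulf_neq0.
exists (c%:MP *: w * 'X + (b *: q)%:P).
rewrite rmorphD rmorphM /= map_polyZ map_polyX map_polyC /= map_mpolyC hw map_mpolyZ hq.
rewrite scalerDr [in RHS]scalerAl; congr (_ * 'X + _).
  by rewrite scalerA -mpolyCM -rmorphM mulrC.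
by rewrite -mul_polyC -polyCM mul_mpolyC scalerA -rmorphM.
Qed.

Lemma tfm_inj : injective tfm.
Proof.
move=> p q /mpolyP h; apply/mpolyP => m; apply/eqP; rewrite -tofrac_eq.
by apply/eqP; have := h m; rewrite !mcoeff_map_mpoly.
Qed.

Lemma size_clear (v : {poly {mpoly E[n]}}) w b : b != 0 ->
  map_poly tfm w = (b%:F)%:MP *: v -> size w = size v.
Proof.
move=> nzb e; rewrite -(size_map_inj_poly tfm_inj) ?rmorph0 // e size_scale //.
by rewrite mpolyC_eq0 tofrac_eq0.
Qed.

(** Multiplication by a nonzero scalar commutes with [nabla] and keeps the size, so a denominator
    can be carried through every generation step under the same bound [k]. *)
Lemma clear_Dgen (s : R) (f : {mpoly R[n]}) j k v : Dgen s%:F (tfm f) j k v ->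
  exists2 b, b != 0 & exists2 w, Dgen s f j k w & map_poly tfm w = (b%:F)%:MP *: v.
Proof.
elim=> [h|w h|u w _ [b nzb [u' hu eu]] _ [c nzc [w' hw ew]]|p u _ [b nzb [u' hu eu]]
       |l u _ [b nzb [u' hu eu]] h].
- exists 1; rewrite ?oner_neq0 //; exists 'X^j; first exact: Dgen_base.
  by rewrite map_polyXn rmorph1 scale1r.
- have [b nzb [w' hw]] := clear_poly w; exists b => //.
  exists ((f *: 'X - 1) * w'); first by apply: Dgen_rel; rewrite (size_clear nzb hw).
  by rewrite map_rel hw scalerAr.
- exists (b * c); first by rewrite mulf_neq0.
  exists (c%:MP *: u' + b%:MP *: w'); first by apply: Dgen_add; apply: Dgen_scale.
  rewrite rmorphD /= !map_polyZ /= !map_mpolyC eu ew scalerDr !scalerA -!mpolyCM -!rmorphM.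
  by rewrite [c * b]mulrC.
- have [c nzc [p' hp]] := clear_mpoly p; exists (c * b); first by rewrite mulf_neq0.
  exists (p' *: u'); first exact: Dgen_scale.
  rewrite map_polyZ /= hp eu !scalerA; congr (_ *: _).
  by rewrite -mul_mpolyC rmorphM mpolyCM mulrAC.
- exists b => //; exists (nabla s f l u').
    by apply: Dgen_nabla; rewrite ?(size_clear nzb eu).
  by rewrite map_nabla eu nablaZ mderivC scale0r add0r.
Qed.

End ClearDenominators.

(** * Specialization of the functional equation at negative integers *)

Lemma natr_inj_pchar0 (K : fieldType) : [pchar K] =i pred0 ->
  injective (fun m : nat => m%:R : K).
Proof.
move=> charK; suff inj m m' : (m <= m')%N -> m%:R = m'%:R :> K -> m = m'.
  by move=> m m' e; case/orP: (leq_total m m') => h; [|apply/esym]; apply: inj.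
move=> le /esym/eqP; rewrite -subr_eq0 -natrB //; move/pcharf0P: charK => ->.
by rewrite subn_eq0 => h; apply/eqP; rewrite eqn_leq le.
Qed.

(** A nonzero polynomial has finitely many roots, and in characteristic zero the [- m%:R] are
    pairwise distinct. *)
Lemma poly_neg_nat_nonroot (K : fieldType) (b : {poly K}) : [pchar K] =i pred0 -> b != 0 ->
  exists m0, forall m, (m0 <= m)%N -> b.[- m%:R] != 0.
Proof.
move=> charK nzb; apply: NNPP => hno.
have hr m0 : exists2 m, (m0 <= m)%N & root b (- m%:R).
  apply: NNPP => h; apply: hno; exists m0 => m hm; apply/eqP => e; apply: h.
  by exists m => //; apply/eqP.
have [rs [szr ur ar]] : exists rs : seq nat,
    [/\ size rs = size b, uniq rs & all (fun m => root b (- m%:R)) rs].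
  elim: (size b) => [|t [rs [szr ur ar]]]; first by exists [::].
  have [m hm rm] := hr (\max_(i <- rs) i).+1; exists (m :: rs); split=> /=.
  - by rewrite szr.
  - rewrite ur andbT; apply: contraL hm => hin.
    by rewrite -ltnNge ltnS; apply: (@leq_bigmax_seq _ rs xpredT id m).
  - by rewrite rm.
have := max_poly_roots nzb (rs := [seq - m%:R | m <- rs]); rewrite all_map ar.
rewrite size_map szr ltnn => /(_ isT); rewrite map_inj_uniq // ?ur => [/(_ isT) //|].
by move=> m m' /oppr_inj; apply: natr_inj_pchar0.
Qed.

(** The functional equation holds over K(s). Clearing denominators brings it to K[s] with a nonzero
    factor b(s), and evaluation at s = -m gives [c] = b(-m), nonzero for large m. *)
Lemma bernstein_specialised (K : fieldType) (charK : [pchar K] =i pred0) n (f : {mpoly K[n]}) :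
  exists j k m0, forall m, (m0 <= m)%N -> exists2 c : K, c != 0 &
    Dgen (- m%:R) f j k (c%:MP *: 'X^(j.+1)).
Proof.
pose fR := map_mpoly (@polyC K) f; pose fE := map_mpoly (@FracField.tofrac {poly K}) fR.
have charE : [pchar {fraction {poly K}}] =i pred0.
  move=> p; rewrite -(charK p) -(fmorph_pchar (@FracField.tofrac {poly K} \o @polyC K)) //.
have [j [k /clear_Dgen [b nzb [w hw ew]]]] :=
  @bernstein_sato _ charE n (FracField.tofrac 'X) fE (msize fE) (leqnSn _).
have {ew} ew : w = b%:MP *: 'X^(j.+1).
  apply: (map_inj_poly (@tfm_inj {poly K} n)); first by rewrite rmorph0.
  by rewrite ew map_polyZ map_polyXn /= map_mpolyC.
have [m0 hm0] := poly_neg_nat_nonroot charK nzb.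
exists j, k, m0 => m hm; exists b.[- m%:R]; first exact: hm0.
have := map_Dgen (horner_eval (- m%:R)) hw.
rewrite ew map_polyZ map_polyXn /= map_mpolyC {1}/horner_eval hornerX.
suff -> : map_mpoly (horner_eval (- m%:R)) fR = f by [].
by apply/mpolyP => i; rewrite !mcoeff_map_mpoly /= /horner_eval hornerC.
Qed.

(** * Homogeneous components and Euler's identity *)

Section Homogeneity.

Variables (K : fieldType) (n : nat).
Local Notation A := {mpoly K[n]}.

(** The component of degree [e - c], zero if [e < c]; the additive condition avoids truncated
    subtraction. *)
Definition hproj (c e : nat) (p : A) : A :=
  \sum_(m <- msupp p | (mdeg m + c)%N == e) p@_m *: 'X_[m].

Lemma mcoeff_hproj c e p m : (hproj c e p)@_m = if (mdeg m + c)%N == e then p@_m else 0.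
Proof.
rewrite raddf_sum /= big_mkcond.
have [hm|hm] := boolP (m \in msupp p).
  rewrite (bigD1_seq m) ?msupp_uniq //= big1 ?addr0 => [|i /negPf hi]; case: ifP => _ //.
    by rewrite mcoeffZ mcoeffX eqxx mulr1.
  by rewrite mcoeffZ mcoeffX hi mulr0.
rewrite (memN_msupp_eq0 hm) if_same big_seq big1 // => i hi; case: ifP => // _.
by rewrite mcoeffZ mcoeffX; case: eqP hi hm => [->->//|_ _ _]; rewrite mulr0.
Qed.

Lemma hprojD c e : {morph hproj c e : p q / p + q}.
Proof.
by move=> p q; apply/mpolyP => m; rewrite mcoeffD !mcoeff_hproj mcoeffD; case: ifP; rewrite ?addr0.
Qed.

Lemma hproj0 c e : hproj c e 0 = 0.
Proof. by apply/mpolyP => m; rewrite mcoeff_hproj mcoeff0 if_same. Qed.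

Lemma hprojN c e : {morph hproj c e : p / - p}.
Proof. by move=> p; apply/mpolyP => m; rewrite mcoeffN !mcoeff_hproj mcoeffN; case: ifP; rewrite ?oppr0. Qed.

Lemma hproj_natl c e k (p : A) : hproj c e (k%:R * p) = k%:R * hproj c e p.
Proof.
apply/mpolyP => m; rewrite !mulr_natl mcoeffMn !mcoeff_hproj mcoeffMn.
by case: ifP; rewrite ?mul0rn.
Qed.

Lemma hproj_sum c e (I : Type) (r : seq I) (F : I -> A) :
  hproj c e (\sum_(i <- r) F i) = \sum_(i <- r) hproj c e (F i).
Proof. exact: (big_morph _ (hprojD c e) (hproj0 c e)). Qed.

Lemma hproj_mderiv c e l p : mderiv l (hproj c e p) = hproj c.+1 e (mderiv l p).
Proof.
apply/mpolyP => m; rewrite mcoeff_deriv !mcoeff_hproj mcoeff_deriv mdegD mdeg1 addn1 addSnnS.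
by case: ifP => _; rewrite ?mul0rn.
Qed.

Lemma hproj_homog c e e' (h : A) : h \is e'.-homog ->
  hproj c e h = if (e' + c)%N == e then h else 0.
Proof.
move=> /dhomogP hh; apply/mpolyP => m; rewrite mcoeff_hproj.
have [hm|hm] := boolP (m \in msupp h); first by rewrite (hh m hm); case: ifP; rewrite ?mcoeff0.
by rewrite (memN_msupp_eq0 hm) if_same; case: eqP => _; rewrite ?mcoeff0 ?(memN_msupp_eq0 hm).
Qed.

Lemma hprojM (c e k : nat) (g p : A) : g \is k.-homog -> hproj c (e + k)%N (g * p) = g * hproj c e p.
Proof.
move=> hg; elim/mpolyind: p => [|x m p _ _ IH]; first by rewrite mulr0 !hproj0 mulr0.
rewrite mulrDr !hprojD IH mulrDr; congr (_ + _).
have hX : x *: 'X_[m] \is (mdeg m).-homog by apply: dhomogZ; rewrite dhomogX.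
rewrite (hproj_homog _ _ (dhomogM hg hX)) (hproj_homog _ _ hX).
have -> : (k + mdeg m + c == e + k)%N = (mdeg m + c == e)%N by apply/eqP/eqP; lia.
by case: ifP; rewrite ?mulr0.
Qed.

Lemma hprojSS c e p : hproj c.+1 e.+1 p = hproj c e p.
Proof. by apply/mpolyP => m; rewrite !mcoeff_hproj addnS eqSS. Qed.

Lemma euler_mcoeff (g : A) m : (\sum_l 'X_l * mderiv l g)@_m = (mdeg m)%:R * g@_m.
Proof.
elim/mpolyind: g => [|x k p _ _ IH].
  by rewrite mcoeff0 mulr0 big1 ?mcoeff0 // => l _; rewrite mderiv0 mulr0.
under eq_bigr => l _ do rewrite mderivD mulrDr.
rewrite big_split mcoeffD IH mcoeffD mulrDr; congr (_ + _).
have -> : \sum_l 'X_l * mderiv l (x *: 'X_[k]) = (mdeg k)%:R *: (x *: 'X_[k]) :> A.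
  rewrite mdegE natr_sum scaler_suml; apply: eq_bigr => l _.
  rewrite mderivZ mderivX -!scalerAr; have [->|hl] := eqVneq (k l) 0%N.
    by rewrite !scale0r scaler0.
  rewrite -mpolyXD scalerA [x * _]mulrC -scalerA addmC submK //.
  by apply/mnm_lepP => i; rewrite mnm1E; case: eqP => // <-; rewrite lt0n.
rewrite !mcoeffZ mcoeffX; case: eqP => [->//|_]; by rewrite !mulr0.
Qed.

Lemma euler_homog k (g : A) : g \is k.-homog -> \sum_l 'X_l * mderiv l g = k%:R *: g.
Proof.
move=> /dhomogP hg; apply/mpolyP => m; rewrite euler_mcoeff mcoeffZ.
have [hm|hm] := boolP (m \in msupp g); first by rewrite (hg m hm).
by rewrite (memN_msupp_eq0 hm) !mulr0.
Qed.

Lemma mderiv_homog k l (g : A) : g \is k.+1.-homog -> mderiv l g \is k.-homog.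
Proof.
move=> /dhomogP hg; apply/dhomogP => m; rewrite mcoeff_msupp mcoeff_deriv => h.
have : (m + U_(l))%MM \in msupp g.
  by rewrite mcoeff_msupp; apply: contra_neq h => ->; rewrite mul0rn.
by move/hg; rewrite /= mdegD mdeg1 addn1 => -[].
Qed.

(** In [n] variables div(x g) = (n + deg g) g for homogeneous g, and here n + deg g = [e]. *)
Lemma divergence_hproj e (p : A) :
  \sum_l mderiv l ('X_l * hproj n e p) = e%:R *: hproj n e p.
Proof.
transitivity (\sum_(l < n) hproj n e p + \sum_l 'X_l * mderiv l (hproj n e p)).
  rewrite -big_split; apply: eq_bigr => l _ /=; rewrite mderivM mderivX mnm1E eqxx.
  rewrite (_ : (U_(l) - U_(l))%MM = 0%MM) ?mpolyX0 ?scale1r ?mul1r //.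
  by apply/mnmP => i; rewrite mnmBE subnn mnm0E.
rewrite sumr_const card_ord; apply/mpolyP => m.
rewrite mcoeffD euler_mcoeff mcoeffMn mcoeffZ mcoeff_hproj.
case: eqP => [<-|_]; first by rewrite natrD mulrDl addrC !mulr_natl.
by rewrite !mulr0 mul0rn addr0.
Qed.

End Homogeneity.

(** * Absorbing the relation into total derivatives *)

Section EulerReduction.

Variables (K : fieldType) (charK : [pchar K] =i pred0) (n : nat).
Local Notation A := {mpoly K[n.+1]}.
Variables (f : A) (d : nat) (hd : (0 < d)%N) (hf : f \is d.-homog).

(* A homogeneous w satisfies w / f^p - w f / f^(p+1) = div (x w / f^p) / (p d), so the
   relation a f / f^(p+1) = a / f^p may be traded for total derivatives. *)
Lemma euler_absorb (a : A) (B : nat -> 'I_n.+1 -> A) (w : nat -> A) q :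
  (0 < q)%N -> (forall m, m \in msupp a -> (mdeg m + n.+1 = q * d)%N) ->
  (forall p, (q <= p)%N -> (if p == q then a else 0) =
     \sum_l (mderiv l (B p l) - (p.-1)%:R * (mderiv l f * B p.-1 l)) + (f * w p.-1 - w p)) ->
  exists B' : nat -> 'I_n.+1 -> A,
    (forall p, (q <= p)%N -> (if p == q then a else 0) =
     \sum_l (mderiv l (B' p l) - (p.-1)%:R * (mderiv l f * B' p.-1 l))) /\
    (forall p, (forall l, B p l = 0) -> w p = 0 -> forall l, B' p l = 0).
Proof.
move=> hq ha hB; have n0 p : ((p.+1 * d)%N%:R == 0 :> K) = false.
  by move/pcharf0P: charK => ->; rewrite muln_eq0 /=; case: d hd.
(* At order p a numerator of total degree -n-1 has degree p d - n - 1, and a vector field, before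
   its derivative is taken, p d - n. After projection, x w_p / (p d) has divergence w_p. *)
exists (fun p l => hproj n (p * d)%N (B p l) - (p * d)%N%:R^-1 *: ('X_l * hproj n.+1 (p * d)%N (w p))).
split=> [p hp|p Bp wp l]; last by rewrite Bp wp !hproj0 mulr0 scaler0 subrr.
rewrite [LHS](_ : _ = hproj n.+1 (p * d)%N (if p == q then a else 0)); last first.
  case: eqP => [->|_]; last by rewrite hproj0.
  apply/mpolyP => m; rewrite mcoeff_hproj.
  by have [/ha ->|/memN_msupp_eq0 ->] := boolP (m \in msupp a); rewrite ?eqxx ?if_same.
case: p hp => [|p] hp; first by move: hq; rewrite ltnNge hp.
rewrite hB // hprojD hproj_sum hprojD hprojN /=.
have fl l (b : A) c : mderiv l f * hproj c (p * d)%N b = hproj c.+1 (p.+1 * d)%N (mderiv l f * b).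
  case: d hd hf => // d' _ hf'.
  have -> : (p.+1 * d'.+1)%N = (p * d'.+1 + d').+1 by lia.
  by rewrite hprojSS hprojM //; apply: mderiv_homog.
have ff (b : A) c : f * hproj c (p * d)%N b = hproj c (p.+1 * d)%N (f * b).
  by rewrite mulSn addnC hprojM.
have e1 : \sum_l mderiv l ((p.+1 * d)%N%:R^-1 *: ('X_l * hproj n.+1 (p.+1 * d)%N (w p.+1)))
    = hproj n.+1 (p.+1 * d)%N (w p.+1).
  under eq_bigr => l _ do rewrite mderivZ.
  by rewrite -scaler_sumr divergence_hproj scalerA mulVf ?scale1r ?n0.
have e2 : \sum_l p%:R * (mderiv l f * ((p * d)%N%:R^-1 *: ('X_l * hproj n.+1 (p * d)%N (w p))))
    = f * hproj n.+1 (p * d)%N (w p).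
  case: p {hp hB fl ff e1} => [|p].
    (* At pole order 0 both sides vanish, the right one because no monomial satisfies
       [mdeg m + n.+1 = 0]. *)
    rewrite big1 => [|l _]; last by rewrite mul0r.
    rewrite [hproj _ _ _](_ : _ = 0) ?mulr0 //.
    by apply/mpolyP => m; rewrite mcoeff_hproj mcoeff0 mul0n addnS.
  set u := hproj _ _ _; set c := _^-1.
  transitivity ((p.+1)%:R * (c *: (u * \sum_l 'X_l * mderiv l f))).
    rewrite mulr_sumr scaler_sumr mulr_sumr; apply: eq_bigr => l _; congr (_ * _).
    by rewrite -scalerAr; congr (_ *: _); ring.
  rewrite (euler_homog hf) -!scalerAr scalerA mulr_natl -scaler_nat scalerA.
  by rewrite -mulrA -natrM [(d * _)%N]mulnC mulVf ?n0 // scale1r mulrC.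
rewrite -ff -{1}e1 -e2 -sumrB -big_split /=; apply: eq_bigr => l _.
rewrite hprojD hprojN hproj_natl -hproj_mderiv -fl mderivB. ring.
Qed.

End EulerReduction.

(** * Fractions with poles along f and the relations W *)

Section PoleReduction.

Variables (K : fieldType) (n : nat).
Local Notation A := {mpoly K[n.+1]}.
Local Notation F := {fraction A}.
Local Notation "p %:F" := (@FracField.tofrac A p) : ring_scope.
Variables (f : A) (hf0 : f != 0).

Lemma fden_neq0 q : f%:F ^+ q != 0.
Proof. by rewrite expf_neq0 // tofrac_eq0. Qed.

Lemma mderiv_exp l q : mderiv l (f ^+ q) * f = q%:R * (mderiv l f * f ^+ q).
Proof.
elim: q => [|q IH]; first by rewrite expr0 mderivC !mul0r.
by rewrite exprS mderivM mulrDl -[f * _ * f]mulrA IH -natr1; ring.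
Qed.

Lemma fderiv_pole l (b : A) q : fderiv l (b%:F / f%:F ^+ q) =
  (mderiv l b * f - q%:R * (b * mderiv l f))%:F / f%:F ^+ q.+1.
Proof.
rewrite -!rmorphXn fderivE ?expf_neq0 //; apply/eqP; rewrite eq_frac ?expf_neq0 //.
apply/eqP; rewrite [in X in _ * X = _]exprS; have := mderiv_exp l q; move: (mderiv l (f ^+ q)) => x hx.
transitivity (mderiv l b * f ^+ q * (f ^+ q * f) - b * (f ^+ q * (x * f))); first by ring.
by rewrite hx; ring.
Qed.

Lemma pole_raise (a : A) q k : a%:F / f%:F ^+ q = (a * f ^+ k)%:F / f%:F ^+ (q + k).
Proof. by rewrite rmorphM rmorphXn exprD /= -mulf_div divff ?mulr1 ?fden_neq0. Qed.

(** The numerator, over [f ^+ q.+1], of the divergence of b / f^q. *)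
Definition pole_div q (b : 'I_n.+1 -> A) : A :=
  \sum_l (mderiv l (b l) * f - q%:R * (b l * mderiv l f)).

Lemma sum_fderiv_pole q (b : 'I_n.+1 -> A) :
  \sum_l fderiv l ((b l)%:F / f%:F ^+ q) = (pole_div q b)%:F / f%:F ^+ q.+1.
Proof. by rewrite rmorph_sum mulr_suml; apply: eq_bigr => l _; rewrite fderiv_pole. Qed.

(** [Q0] is the largest pole order among the B_l. Allowing every larger [Q] lets two such sums share
    a denominator. *)
Lemma sum_dAf_pole (R : F) : sum_dAf f R -> exists Q0, forall Q, (Q0 <= Q)%N ->
  exists b, R = (pole_div Q b)%:F / f%:F ^+ Q.+1.
Proof.
move=> [B [/fin_all_exists [q /fin_all_exists [a ha]] ->]].
exists (\max_l q l) => Q hQ; exists (fun l => a l * f ^+ (Q - q l)).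
rewrite -sum_fderiv_pole; apply: eq_bigr => l _; rewrite {1}ha.
by rewrite [in LHS](pole_raise _ _ (Q - q l)) subnKC // (leq_trans (leq_bigmax l)).
Qed.

Lemma pole_sum_dAf q b : sum_dAf f ((pole_div q b)%:F / f%:F ^+ q.+1).
Proof.
exists (fun l => (b l)%:F / f%:F ^+ q); split; last by rewrite sum_fderiv_pole.
by move=> l; exists q, (b l).
Qed.

Lemma sum_dAfB R S : sum_dAf f R -> sum_dAf f S -> sum_dAf f (R - S).
Proof.
move=> /sum_dAf_pole [Q1 h1] /sum_dAf_pole [Q2 h2].
have [b ->] := h1 (maxn Q1 Q2) (leq_maxl _ _).
have [c ->] := h2 (maxn Q1 Q2) (leq_maxr _ _).
rewrite -mulrBl -rmorphB; set Q := maxn _ _.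
have -> : pole_div Q b - pole_div Q c = pole_div Q (fun l => b l - c l).
  by rewrite /pole_div -sumrB; apply: eq_bigr => l _; rewrite mderivB; ring.
exact: pole_sum_dAf.
Qed.

Lemma sum_dAf0 : sum_dAf f 0.
Proof.
have := pole_sum_dAf 0 (fun=> 0); rewrite /pole_div big1 ?rmorph0 ?mul0r // => l _.
by rewrite mderiv0; ring.
Qed.

Lemma W_M r q R R' : W f r q R R' -> M f q.-1 R'.
Proof.
case: r => [//|r]; elim: r q R R' => [|r IH] q R R' /=; first by case=> b [_ ->]; eexists.
by case=> S [T [_ /IH]].
Qed.

(** For a pair in W_q^1 the difference is - div(b / f^(q-1)). Inductively, R - R' = (S - R') - (0 -
    T). *)
Lemma W_sum_dAf r q R R' : (0 < q)%N -> W f r q R R' -> sum_dAf f (R - R').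
Proof.
case: r => [//|r]; elim: r q R R' => [|r IH] [//|q] R R' _.
  case=> b [-> ->] /=; rewrite -[X in sum_dAf f X]opprB -sub0r.
  apply: sum_dAfB; first exact: sum_dAf0.
  suff -> : (\sum_l mderiv l (b l))%:F / f%:F ^+ q -
      q%:R * ((\sum_l b l * mderiv l f)%:F / f%:F ^+ q.+1) =
      (pole_div q b)%:F / f%:F ^+ q.+1 by apply: pole_sum_dAf.
  rewrite (pole_raise _ q 1) addn1 expr1 mulrA -mulrBl -(rmorph_nat (@FracField.tofrac A)).
  rewrite -rmorphM -rmorphB /pole_div mulr_suml mulr_sumr -sumrB; congr (_%:F / _).
case=> S [T [-> /IH hS /IH hT]]; have -> : S + T - R' = (S - R') - (0 - T) by ring.
by apply: sum_dAfB; [apply: hS|apply: hT].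
Qed.

Lemma W_zero r q : W f r.+1 q 0 0.
Proof.
elim: r q => [|r IH] q; last by exists 0, 0; rewrite addr0; split=> //; apply: IH.
by exists (fun=> 0); rewrite !big1 ?rmorph0 ?mul0r ?mulr0 // => l _; rewrite ?mderiv0 ?mul0r.
Qed.

Lemma WS r q R R' : W f r.+1 q R R' -> W f r.+2 q R R'.
Proof. by move=> h; exists R, 0; rewrite addr0; split=> //; apply: W_zero. Qed.

Lemma W_mono r r' q R R' : (r <= r')%N -> W f r.+1 q R R' -> W f r'.+1 q R R'.
Proof.
by elim: r' => [|r' IH]; rewrite leq_eqVlt => /orP [/eqP <- //|//] /IH h /h /WS.
Qed.

Lemma W_linear r q (x : K) R R' S S' : W f r.+1 q R R' -> W f r.+1 q S S' ->
  W f r.+1 q ((x%:MP)%:F * R + S) ((x%:MP)%:F * R' + S').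
Proof.
elim: r q R R' S S' => [|r IH] q R R' S S'.
  case=> b [-> ->] [c [-> ->]]; exists (fun l => x%:MP * b l + c l); split.
    have -> : \sum_l (x%:MP * b l + c l) * mderiv l f =
        x%:MP * (\sum_l b l * mderiv l f) + \sum_l c l * mderiv l f.
      by rewrite mulr_sumr -big_split; apply: eq_bigr => l _; rewrite mulrDl mulrA.
    by rewrite rmorphD rmorphM /=; ring.
  have -> : \sum_l mderiv l (x%:MP * b l + c l) =
      x%:MP * (\sum_l mderiv l (b l)) + \sum_l mderiv l (c l).
    by rewrite mulr_sumr -big_split; apply: eq_bigr => l _; rewrite mderivD mderiv_mulC.
  by rewrite rmorphD rmorphM /=; ring.
case=> R1 [R2 [-> h1 h2]] [S1 [S2 [-> h3 h4]]].
exists ((x%:MP)%:F * R1 + S1), ((x%:MP)%:F * R2 + S2); split.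
- by ring.
- exact: IH.
- by have := IH _ _ _ _ _ h2 h4; rewrite mulr0 addr0.
Qed.

(** Each [b i] is a vector field of pole order q - 1 + i, and the hypothesis makes the contributions
    above order q cancel. So [b 0] yields a pair of W_q^1, and the tail, one order higher, a pair
    (0, T). *)
Lemma W_chain r q (b : nat -> 'I_n.+1 -> A) : (0 < q)%N ->
  (forall i, (0 < i)%N ->
     (q.-1 + i)%:R * (\sum_l b i l * mderiv l f) + \sum_l mderiv l (b i.+1 l) = 0) ->
  (forall l, b r.+1 l = 0) ->
  W f r.+1 q (((q.-1)%:R * (\sum_l b 0%N l * mderiv l f) + \sum_l mderiv l (b 1%N l))%:F / f%:F ^+ q)
    ((\sum_l mderiv l (b 0%N l))%:F / f%:F ^+ q.-1).
Proof.
elim: r q b => [|r IH] q b hq hb hr.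
  exists (b 0%N); split=> //; rewrite [X in _ + X]big1 ?addr0 => [|l _]; last by rewrite hr mderiv0.
  by rewrite rmorphM rmorph_nat mulrA.
exists ((q.-1)%:R * ((\sum_l b 0%N l * mderiv l f)%:F / f%:F ^+ q)),
  ((\sum_l mderiv l (b 1%N l))%:F / f%:F ^+ q); split.
- by rewrite rmorphD rmorphM rmorph_nat mulrDl mulrA.
- by apply: (W_mono (leq0n r)); exists (b 0%N).
case: q hq hb => // q _ hb.
have := IH q.+2 (fun i => b i.+1) isT; rewrite /= -[q.+1]addn1 hb // rmorph0 mul0r.
by apply=> // i hi; rewrite addn1 addSnnS hb.
Qed.

(** * Bounds on r for fractions of degree -n-1 *)

Variables (charK : [pchar K] =i pred0) (d : nat) (hd : (0 < d)%N) (hf : f \is d.-homog).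

(** Says additively that every term of a / f^q has degree -n-1. *)
Definition pole_degree q (a : A) := forall m, m \in msupp a -> (mdeg m + n.+1 = q * d)%N.

(** The hypothesis writes the symbol of a / f^q, in pole orders at least [q], as a total derivative
    plus a multiple of the relation. [euler_absorb] removes the relation, and [W_chain] turns the
    rest into a pair; lower orders make up R'. *)
Lemma formal_W (a : A) q r (B : nat -> 'I_n.+1 -> A) (w : nat -> A) : (0 < q)%N ->
  pole_degree q a ->
  (forall p, (q <= p)%N -> (if p == q then a else 0) =
     \sum_l (mderiv l (B p l) - (p.-1)%:R * (mderiv l f * B p.-1 l)) + (f * w p.-1 - w p)) ->
  (forall p, (q + r <= p)%N -> (forall l, B p l = 0) /\ w p = 0) ->
  exists R', W f r.+1 q (a%:F / f%:F ^+ q) R'.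
Proof.
move=> hq ha hB h0; have [B' [hB' hB0]] := euler_absorb charK hd hf hq ha hB.
(* Alternating signs turn the minus in the derivative of a fraction into the plus of [W_chain]. *)
pose b i l : A := (-1) ^+ i.+1 * B' (q.-1 + i)%N l.
have hb i : (q.-1 + i)%:R * (\sum_l b i l * mderiv l f) + \sum_l mderiv l (b i.+1 l)
    = (-1) ^+ i * (if i == 0%N then a else 0).
  have := hB' (q + i)%N (leq_addr _ _).
  rewrite -[X in _ == X]addn0 eqn_add2l => ->.
  rewrite !mulr_sumr -big_split; apply: eq_bigr => l _ /=; rewrite /b.
  have -> : (q + i).-1 = (q.-1 + i)%N by lia.
  have -> : (q.-1 + i.+1)%N = (q + i)%N by lia.
  have -> (x : A) : mderiv l ((-1) ^+ i.+2 * x) = (-1) ^+ i * mderiv l x.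
    rewrite !exprS mulrA mulrNN mul1r !mul1r -signr_odd.
    by case: odd; rewrite ?expr1 ?expr0 ?mulN1r ?mul1r ?mderivN.
  by rewrite exprS; ring.
have := @W_chain r q b hq; rewrite -[q.-1 in X in _ -> _ -> W _ _ _ X _]addn0 hb mul1r => h.
eexists; apply: h => [i hi|l].
  by rewrite hb; case: i hi => // i _; rewrite mulr0.
by rewrite /b hB0 ?mulr0 //; case: (h0 (q.-1 + r.+1)%N) => //; lia.
Qed.

Lemma sum_dAf_W (a : A) q : (0 < q)%N -> pole_degree q a ->
  sum_dAf f (a%:F / f%:F ^+ q) -> exists r R', W f r.+1 q (a%:F / f%:F ^+ q) R'.
Proof.
move=> hq ha /sum_dAf_pole [Q0 /(_ (maxn Q0 q) (leq_maxl _ _))].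
have : (q <= maxn Q0 q)%N := leq_maxr _ _; move: (maxn Q0 q) => Q hQ [b hb].
have {}hb : a * f ^+ (Q.+1 - q) = pole_div Q b.
  move: hb; rewrite (pole_raise _ _ (Q.+1 - q)) subnKC; last exact: leq_trans hQ _.
  by move/(mulIf (invr_neq0 (fden_neq0 _)))/eqP; rewrite tofrac_eq => /eqP.
exists (Q.+1 - q)%N; pose e := \sum_l mderiv l (b l).
(* The part - a f^(p-q) of w telescopes [a] from order q up to Q + 1, and [e] carries div b from
   order Q to Q + 1, where [hb] compares them. *)
apply: (@formal_W a q _ (fun p l => if p == Q then b l else 0)
  (fun p => (if p == Q then e else 0) - (if (q <= p <= Q)%N then a * f ^+ (p - q) else 0))) => //.
- move=> p hp.
  have hs : \sum_l (mderiv l (if p == Q then b l else 0) -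
      (p.-1)%:R * (mderiv l f * (if p.-1 == Q then b l else 0))) =
      (if p == Q then e else 0) - (if p.-1 == Q then Q%:R * \sum_l b l * mderiv l f else 0).
    rewrite sumrB; congr (_ - _); first by case: eqP => _ //; rewrite big1 // => l _; rewrite mderiv0.
    case: eqP => [->|_]; last by rewrite big1 // => l _; rewrite !mulr0.
    by rewrite mulr_sumr; apply: eq_bigr => l _; rewrite [b l * _]mulrC.
  rewrite hs; have hdiv : pole_div Q b = e * f - Q%:R * \sum_l b l * mderiv l f.
    by rewrite /pole_div sumrB mulr_suml mulr_sumr.
  rewrite hdiv in hb.
  have F (P : bool) : ~ P -> P = false by case: P => // /(_ isT).
  (* Up to order Q the terms telescope, at Q + 1 the identity is [hb], and above it everything
     vanishes. *)
  have [hpQ|[hpQ|hpQ]] : (p.-1 < Q \/ p.-1 = Q \/ Q < p.-1)%N by lia.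
  + have -> : (q <= p <= Q)%N by lia.
    have -> : (p.-1 == Q) = false by apply: F => /eqP; lia.
    have [->|hpq] := eqVneq p q.
      have -> : (q <= q.-1 <= Q)%N = false by lia.
      by rewrite subnn; ring.
    have -> : (q <= p.-1 <= Q)%N by lia.
    have -> : (p - q)%N = (p.-1 - q).+1 by lia.
    by rewrite exprS; ring.
  + have -> : p = Q.+1 by lia.
    have -> : (Q.+1 == Q) = false by apply: F => /eqP; lia.
    have -> : (Q.+1 == q) = false by apply: F => /eqP; lia.
    have -> : (q <= Q.+1 <= Q)%N = false by lia.
    rewrite /= eqxx hQ leqnn /= subr0 sub0r mulrBr.
    move: hb; rewrite subSn // exprS => hb.
    have -> : f * (a * f ^+ (Q - q)) = a * (f * f ^+ (Q - q)) by ring.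
    by rewrite hb; ring.
  + have -> : (p == Q) = false by apply: F => /eqP; lia.
    have -> : (p.-1 == Q) = false by apply: F => /eqP; lia.
    have -> : (q <= p.-1 <= Q)%N = false by lia.
    have -> : (q <= p <= Q)%N = false by lia.
    have -> : (p == q) = false by apply: F => /eqP; lia.
    by ring.
- move=> p hp; have -> : (p == Q) = false by apply/negP => /eqP; lia.
  by have -> : (q <= p <= Q)%N = false by [lia]; rewrite subr0.
Qed.

(** The functional equation is used at s = -m with m = q - j - 1. Then ['X^(j.+1)] has pole order q,
    while the remainder in ['X^j] has order q - 1, below the range of [formal_W]. The bound [k] is
    the same for all q. *)
Lemma uniform_W : exists q0 r, forall q (a : A), (q0 <= q)%N -> pole_degree q a ->
  exists R', W f r.+1 q (a%:F / f%:F ^+ q) R'.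
Proof.
have [j [k [m0 h]]] := bernstein_specialised charK f.
exists (m0 + j.+1)%N, k => q a hq ha.
have [|c nzc hc] := h (q - j.+1)%N; first by lia.
move: hc; have : q = (q - j.+1 + j.+1)%N by lia.
move: (q - j.+1)%N => m {hq h} hq /Dgen_adjoint /(_ (c^-1%:MP * a)) [x [B [w [hB hw]]]].
rewrite scalerA mulrAC -mpolyCM mulVf // mpolyC1 mul1r => e.
apply: (@formal_W a q k (fun p l => (B l)`_(p - m)) (fun p => w`_(p - m))) => //; first by lia.
  move=> p hp; have [i hi] : exists i, (p - m)%N = i.+1 by exists (p - m).-1; lia.
  have hi' : (p.-1 - m)%N = i by lia.
  have hp' : p.-1 = (m + i)%N by lia.
  have -> : (if p == q then a else 0) = (a *: 'X^(j.+1))`_i.+1.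
    have -> : (p == q) = (i.+1 == j.+1) by apply/eqP/eqP; lia.
    by rewrite coefZ coefXn; case: eqP; rewrite ?mulr1 ?mulr0.
  rewrite e !coefD coefZ coefXn hi hi' hp'.
  have -> : (i.+1 == j) = false by apply/negP => /eqP; lia.
  rewrite mulr0 add0r mulrBl mul1r coefB -scalerAl coefZ coefXM /= coef_sum; congr (_ + _).
  apply: eq_bigr => l _; rewrite coef_nabla natrD mpolyCN mpolyC_nat; ring.
move=> p hp; split=> [l|]; apply: nth_default; [apply: leq_trans (hB l) _|apply: leq_trans hw _]; lia.
Qed.

Lemma pole_degree_linear q (x : K) (a b : A) :
  pole_degree q a -> pole_degree q b -> pole_degree q (x *: a + b).
Proof.
move=> ha hb m /msuppD_le; rewrite mem_cat => /orP [/msuppZ_le|]; [exact: ha|exact: hb].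
Qed.

(** For fixed [q] the numerators of the right degree form a finite-dimensional space, so the
    increasing chain [X r] stabilizes; [sum_dAf_W] places each relevant numerator in some [X r]. *)
Lemma bounded_W q : (0 < q)%N -> exists r, forall a : A, pole_degree q a ->
  sum_dAf f (a%:F / f%:F ^+ q) -> exists R', W f r.+1 q (a%:F / f%:F ^+ q) R'.
Proof.
move=> hq; pose X r (a : A) := pole_degree q a /\ exists R', W f r.+1 q (a%:F / f%:F ^+ q) R'.
pose J : finType := {ffun 'I_n.+1 -> 'I_(q * d).+1}.
pose mon (x : J) := [multinom (x l : nat) | l < n.+1].
have [] := @subspace_chain_stable K K (idfun : {rmorphism K -> K}) A X #|J|.+1.
- move=> r; split.
    by split=> [m|]; [rewrite msupp0|exists 0; rewrite rmorph0 mul0r; apply: W_zero].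
  move=> x a b [ha [R hR]] [hb [S hS]]; split; first exact: pole_degree_linear.
  exists ((x%:MP)%:F * R + S); have := W_linear x hR hS.
  by rewrite -mul_mpolyC rmorphD rmorphM mulrDl mulrA.
- by move=> r a [ha [R hR]]; split=> //; exists R; apply: WS.
- move=> v hv hi.
  have [|c [i nz] hc] := @wide_kernel K 'I_(#|J|.+1) J (fun i x => (v i)@_(mon x)).
    by rewrite card_ord.
  have := hi (fun i => if insub i is Some i' then c i' else 0) _ i (ltn_ord i).
  rewrite valK => h; move/eqP: nz; apply; apply: h.
  under eq_bigr => l _ do rewrite valK.
  apply/mpolyP => m; rewrite mcoeff0 raddf_sum /=.
  under eq_bigr => l _ do rewrite mcoeffZ.
  have [/forallP hm|/forallPn [l]] := boolP [forall l, (m l <= q * d)%N].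
    pose y : J := [ffun l => inord (m l)].
    have -> : m = mon y by apply/mnmP => l; rewrite mnmE ffunE inordK // ltnS.
    exact: hc.
  rewrite -ltnNge => hl; apply: big1 => t _; rewrite memN_msupp_eq0 ?mulr0 //.
  apply/negP => ht; have [r [hr _]] := hv t; have := hr _ ht.
  by rewrite mdegE (bigD1 l) //=; lia.
move=> r hr; exists r => a ha hs; have [r' hr'] := sum_dAf_W hq ha hs.
by have [|_] := hr r' a.
Qed.

(** The single dilation by 2 determines the degree of every monomial of [a], since powers of 2 are
    distinct in characteristic zero. *)
Lemma homogeneous_pole_degree q (a : A) :
  homogeneous (- n.+1%:Z) (a%:F / f%:F ^+ q) -> pole_degree q a.
Proof.
have n0 := proj1 (pcharf0P K) charK.
have nz2 : (2%:R : K) != 0 by rewrite n0.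
move=> /(_ 2%:R nz2); rewrite -rmorphXn fdilateE ?expf_neq0 //.
have -> : pdilate 2%:R (f ^+ q) = (2%:R ^+ (q * d))%:MP * f ^+ q.
  apply/mpolyP => m; rewrite mcoeff_pdilate mcoeffCM.
  have [hm|/memN_msupp_eq0 ->] := boolP (m \in msupp (f ^+ q)); last by rewrite !mulr0.
  by rewrite (dhomog_mf (dhomogMn q hf) hm) mulnC.
rewrite mulrA -rmorphM => /eqP; rewrite eq_frac ?mulf_neq0 ?expf_neq0 //; last first.
  by rewrite mpolyC_eq0 expf_neq0.
move=> /eqP e m hm.
have {}e : pdilate 2%:R a = (2%:R ^- n.+1 * 2%:R ^+ (q * d))%:MP * a.
  apply: (mulIf (expf_neq0 q hf0)); rewrite e mpolyCM; ring.
have := congr1 (mcoeff m) e; rewrite mcoeff_pdilate mcoeffCM => /mulIf.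
rewrite -mcoeff_msupp => /(_ hm) {}e.
have : 2%:R ^+ (mdeg m + n.+1) = 2%:R ^+ (q * d) :> K.
  by rewrite exprD e mulrAC mulVf ?mul1r // expf_neq0.
by rewrite -!natrX => /(natr_inj_pchar0 charK)/eqP; rewrite eqn_exp2l // => /eqP.
Qed.

End PoleReduction.

(** * The uniform r and the equivalence *)

Theorem theorem4 (K : fieldType) (hK : [pchar K] =i pred0)
    (n : nat) (hn : (1 <= n)%N)
    (f : {mpoly K[n.+1]}) (hf0 : f != 0)
    (d : nat) (hd : (0 < d)%N) (hf : f \is d.-homog) :
  exists r : nat, (1 <= r)%N /\
    forall (q : nat) (R : {fraction {mpoly K[n.+1]}}), (1 <= q)%N ->
      M f q R -> homogeneous (- n.+1%:Z) R ->
      (sum_dAf f R <->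
       exists R' : {fraction {mpoly K[n.+1]}},
         [/\ M f q.-1 R', sum_dAf f R' & W f r q R R']).
Proof.
have [q0 [r0 hr0]] := uniform_W hf0 hK hd hf.
(* For the finitely many q below [q0], the maximum of the individual bounds serves. *)
have [r1 hr1] : exists r, forall q, (0 < q < q0)%N -> forall a, pole_degree d q a ->
    sum_dAf f (FracField.tofrac a / FracField.tofrac f ^+ q) ->
    exists R', W f r.+1 q (FracField.tofrac a / FracField.tofrac f ^+ q) R'.
  elim: q0 {hr0} => [|q1 [r1 hr1]]; first by exists 0%N => q; rewrite ltn0 andbF.
  case: q1 hr1 => [|q1] hr1; first by exists 0%N => q; case: q.
  have [r2 hr2] := bounded_W hf0 hK hd hf (ltn0Sn q1).
  exists (maxn r1 r2) => q /andP [hq]; rewrite ltnS leq_eqVlt => /orP [/eqP -> a ha hs|hlt a ha hs].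
    by have [R' hR'] := hr2 a ha hs; exists R'; apply: W_mono hR'; rewrite leq_maxr.
  have [|R' hR'] := hr1 q _ a ha hs; first by rewrite hq.
  by exists R'; apply: W_mono hR'; rewrite leq_maxl.
exists (maxn r0 r1).+1; split=> // q R hq [a ->] /(homogeneous_pole_degree hf0 hK hf) ha.
(* From (2) to (1): both R - R' and R' are sums of derivatives, hence so is R. *)
split=> [hs|[R' [_ hR' /W_sum_dAf hW]]]; last first.
  have -> : FracField.tofrac a / FracField.tofrac f ^+ q = (FracField.tofrac a / FracField.tofrac f ^+ q - R') - (0 - R') by ring.
  by apply: sum_dAfB => //; [apply: hW|apply: sum_dAfB => //; apply: sum_dAf0].
have [R' hR'] : exists R', W f (maxn r0 r1).+1 q
    (FracField.tofrac a / FracField.tofrac f ^+ q) R'.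
  case: (leqP q0 q) => hlt.
    by have [R' hR'] := hr0 q a hlt ha; exists R'; apply: W_mono hR'; rewrite leq_maxl.
  have [|R' hR'] := hr1 q _ a ha hs; first by rewrite hq.
  by exists R'; apply: W_mono hR'; rewrite leq_maxr.
(* R' is a sum of derivatives as the difference of R and R - R'. *)
exists R'; split=> //; first exact: W_M hR'.
have := sum_dAfB hf0 hs (W_sum_dAf hf0 hq hR').
by rewrite opprB addrC subrK.
Qed.
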